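(* Let $\Bbbk$ be a field, let $$A := \frac{\Bbbk\langle a, b, c, d, e, f, l, m\rangle}{\langle bc - ef,\ ae,\ da-lm,\ cl\rangle},\qquad B := \frac{\Bbbk\langle z\rangle}{\langle z^4\rangle},$$ with all generators in degree $1$, and let $C := A\sqcup B$ be the free product of $A$ and $B$. Then $C$ is $2$-$4$-determined, but the Yoneda algebra $E(C)$ is not finitely generated as a $\Bbbk$-algebra.
   Context: $\Bbbk\langle\ldots\rangle$ denotes the free associative (noncommutative polynomial) algebra on the listed generators, and $\langle\ldots\rangle$ in a denominator denotes the two-sided ideal generated by the listed elements. Free product: for connected graded $\Bbbk$-algebras $A$ and $B$ with augmentation ideals $A_+$, $B_+$, $$A \sqcup B := \bigoplus_{i \geq 0,\ \epsilon_1, \epsilon_2 \in \{0, 1\}} A_+^{\otimes \epsilon_1} \otimes (B_+ \otimes A_+)^{\otimes i} \otimes B_+^{\otimes \epsilon_2},$$ with the usual free product multiplication (so for $A=\mathbb{T}(V)/I$ and $B=\mathbb{T}(W)/J$ it is $\mathbb{T}(V\oplus W)/\langle I, J\rangle$). Yoneda algebra: for a connected graded $\Bbbk$-algebra $R=\mathbb{T}(V)/I$ (with $V$ finite dimensional in degree $1$, $\mathbb{T}(V)$ the free (tensor) algebra, $I$ a homogeneous ideal), $E(R):=\bigoplus_{i,j}\operatorname{Ext}_R^{i,j}(\Bbbk,\Bbbk)$, a bigraded algebra under the Yoneda product, where $i$ is the cohomological degree and $j$ is the internal degree inherited from the grading on $R$. Write $E^{i,j}(R)=\operatorname{Ext}_R^{i,j}(\Bbbk,\Bbbk)$.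 2-$D$-determined: let $D>2$ be an integer, and define $\delta(2k)=Dk$, $\delta(2k+1)=Dk+1$ for $k\ge 0$. The algebra $R=\mathbb{T}(V)/I$ is called 2-$D$-determined if $I$ can be generated by elements of degrees $2$ and $D$, and $E^{i,j}(R)=0$ unless $j\le\delta(i)$. (The case $D=4$ is used here.) *)

(* Defs.v *)
From HB Require Import structures.
From mathcomp Require Import all_boot all_algebra.
From mathcomp Require Import boolp classical_sets.
From mathcomp Require Import finmap monalg.

Set Implicit Arguments.
Unset Strict Implicit.
Unset Printing Implicit Defensive.

Import GRing.Theory.

Local Open Scope ring_scope.
Local Notation "1" := (@mone _) : monom_scope.

(* [gr] writes [M] as the internal direct sum of the subgroups [gr j]. *)
Record is_grading (M : zmodType) (gr : nat -> set M) : Prop := IsGrading {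
  grading0 : forall j, gr j 0;
  gradingB : forall j x y, gr j x -> gr j y -> gr j (x - y);
  grading_span : forall x, exists n, exists c : nat -> M,
    (forall j, gr j (c j)) /\ x = \sum_(j < n) c j;
  grading_indep : forall n (c : nat -> M), (forall j, gr j (c j)) ->
    \sum_(j < n) c j = 0 -> forall j, (j < n)%N -> c j = 0 }.

Section Yoneda.
Variables (K : fieldType) (R : nzRingType) (gR : nat -> set R).
Variable aug : {rmorphism R -> K}.

Definition is_graded_module (M : lmodType R) (gr : nat -> set M) : Prop :=
  is_grading gr /\
  forall i j (r : R) (x : M), gR i r -> gr j x -> gr (i + j)%N (r *: x).

Definition projective (P : lmodType R) : Prop :=
  forall (M N : lmodType R) (p : {linear M -> N}) (f : {linear P -> N}),
    (forall y, exists x, p x = y) ->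
    exists g : {linear P -> M}, forall x, p (g x) = f x.

(* Hom_R(M, K), where R acts on K through [aug].  Modules are left modules
   throughout; right modules give the opposite Yoneda algebra. *)
Definition homk (M : lmodType R) := {linear M -> K | aug \; *%R}.

(* ... -> P_2 -> P_1 -> P_0 -> K -> 0, with maps of internal degree 0 and K
   placed in internal degree 0. *)
Record resolution := Resolution {
  res_mod : nat -> lmodType R;
  res_gr : forall n, nat -> set (res_mod n);
  res_d : forall n, {linear res_mod n.+1 -> res_mod n};
  res_eps : homk (res_mod 0%N);
  res_graded : forall n, is_graded_module (@res_gr n);
  res_proj : forall n, projective (res_mod n);
  res_d_gr : forall n j x, @res_gr n.+1 j x -> @res_gr n j (res_d n x);
  res_eps_gr : forall j x, @res_gr 0%N j x -> (0 < j)%N -> res_eps x = 0;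
  res_eps_surj : forall a, exists x, res_eps x = a;
  res_exact0 : forall x, res_eps x = 0 <-> exists y, x = res_d 0%N y;
  res_exact : forall n x, res_d n x = 0 <-> exists y, x = res_d n.+1 y }.

Variable P : resolution.

(* Hom_R(P_i, K) in internal degree j *)
Definition cochain_deg (i j : nat) (f : homk (res_mod P i)) : Prop :=
  forall j' x, res_gr j' x -> j' <> j -> f x = 0.

Definition coboundary_deg (j i : nat) : homk (res_mod P i) -> Prop :=
  if i is i'.+1 then
    fun f => exists h : homk (res_mod P i'),
      cochain_deg j h /\ forall x, f x = h (res_d P i' x)
  else fun f => forall x, f x = 0.

(* Ext_R^{i,j}(K, K) = 0 *)
Definition ext_eq0 (i j : nat) : Prop :=
  forall f : homk (res_mod P i), cochain_deg j f ->
    (forall x, f (res_d P i x) = 0) -> coboundary_deg j f.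

(* Elements of E(R) are represented by the cocycles in the direct sum over
   (i, j) of the spaces Hom_R(P_i, K)_j; such a cocycle is given by its
   components on the P_i. *)
Definition cochain := forall i, homk (res_mod P i).

Definition finite_cochain (f : cochain) : Prop :=
  exists N, forall i j x, res_gr j x -> (N <= i)%N \/ (N <= j)%N -> f i x = 0.

Definition ext_cocycle (f : cochain) : Prop :=
  finite_cochain f /\ forall i x, f i (res_d P i x) = 0.

Definition cohomologous (f g : cochain) : Prop :=
  (forall x, f 0%N x = g 0%N x) /\
  exists h : cochain, finite_cochain h /\
    forall i x, f i.+1 x = g i.+1 x + h i (res_d P i x).

Definition ext_unit (e : cochain) : Prop :=
  (forall x, e 0%N x = res_eps P x) /\ forall i x, e i.+1 x = 0.

(* [h] represents the Yoneda product of the classes of [f] and [g]: [g] is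
   lifted to a chain endomorphism [G] of [P], which is then composed with [f].
   [G m n] is the component P_m -> P_n, so it belongs to the part of [G] of
   cohomological degree m - n, and only the components with n <= m matter.
   Lifts are unique up to homotopy, so the class of [h] depends only on those
   of [f] and [g]. *)
Definition yoneda_product (f g h : cochain) : Prop :=
  exists G : forall m n, {linear res_mod P m -> res_mod P n},
    [/\ forall m x, res_eps P (G m 0%N x) = g m x,
        forall m n x, res_d P n (G m.+1 n.+1 x) = G m n (res_d P m x)
      & forall m x, h m x = \sum_(n < m.+1) f n (G m n x)].

(* The K-subalgebra of E(R) generated by the classes of the members of [S],
   as a set of representing cocycles. *)
Inductive ext_subalgebra (S : set cochain) : cochain -> Prop :=
| ExtGen f : S f -> ext_subalgebra S f
| ExtUnit e : ext_unit e -> ext_subalgebra S e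
| ExtLin (a : K) (f g h : cochain) : ext_subalgebra S f -> ext_subalgebra S g ->
    (forall i x, h i x = a * f i x + g i x) -> ext_subalgebra S h
| ExtMul f g h : ext_subalgebra S f -> ext_subalgebra S g ->
    ext_cocycle h -> yoneda_product f g h -> ext_subalgebra S h
| ExtCohom f g : ext_subalgebra S f -> ext_cocycle g -> cohomologous f g ->
    ext_subalgebra S g.

Definition yoneda_fin_gen : Prop :=
  exists n, exists s : 'I_n -> cochain, (forall k, ext_cocycle (s k)) /\
    forall f, ext_cocycle f -> ext_subalgebra (range s) f.

End Yoneda.

Notation free_alg K X := {malg K[{fmonom X}]}.

Section Presentations.
Variable K : fieldType.

Definition var (X : choiceType) (x : X) : free_alg K X := << fmu x >>.

Definition homog (X : choiceType) (n : nat) (p : free_alg K X) : Prop :=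
  forall w, w \in msupp p -> fdeg w = n.

Inductive ideal_gen (X : choiceType) (S : set (free_alg K X)) :
    free_alg K X -> Prop :=
| IdealGen p : S p -> ideal_gen S p
| Ideal0 : ideal_gen S 0
| IdealB p q : ideal_gen S p -> ideal_gen S q -> ideal_gen S (p - q)
| IdealM u v p : ideal_gen S p -> ideal_gen S (u * p * v).

(* The connected graded algebra R = T(V)/I, with V the span of [gens] and I the
   two-sided ideal generated by [rels]. *)
Record presentation := Presentation {
  gens : finType;
  rels : set (free_alg K gens);
  rels_homog : forall p, rels p -> exists2 n, (0 < n)%N & homog n p }.

Section Quotient.
Variable A : presentation.

Definition rel_ideal : pred (free_alg K (gens A)) :=
  fun p => `[< ideal_gen (@rels A) p >].

Lemma rel_idealP p : reflect (ideal_gen (@rels A) p) (p \in rel_ideal).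
Proof. exact: asboolP. Qed.

Lemma rel_ideal_zmod : zmod_closed rel_ideal.
Proof.
split=> [|p q /rel_idealP Ip /rel_idealP Iq]; apply/rel_idealP.
  exact: Ideal0.
exact: IdealB.
Qed.

HB.instance Definition _ := GRing.isZmodClosed.Build _ rel_ideal rel_ideal_zmod.

Lemma rel_idealM u v p : p \in rel_ideal -> u * p * v \in rel_ideal.
Proof. by move=> /rel_idealP Ip; apply/rel_idealP/IdealM. Qed.

Lemma rel_ideal_coef1 p : p \in rel_ideal -> p@_1%M = 0.
Proof.
move=> /rel_idealP; elim=> {p} [p /rels_homog[n n0 hp]||p q _ p0 _ q0|u v p _ p0].
- apply: mcoeff_outdom; apply/negP => /hp; rewrite fdeg1 => n0'.
  by rewrite -n0' in n0.
- by rewrite mcoeff0.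
- by rewrite mcoeffB p0 q0 subrr.
- by rewrite !rmorphM /= p0 mulr0 mul0r.
Qed.

Definition alg := Quotient.quot (GRing.ZmodClosed.clone _ rel_ideal _).
HB.instance Definition _ := GRing.Zmodule.on alg.

Definition pi (p : free_alg K (gens A)) : alg := (\pi_alg p)%qT.

Lemma pi_repr (x : alg) : pi (repr x) = x.
Proof. exact: reprK. Qed.

Lemma pi_eq p q : pi p = pi q <-> p - q \in rel_ideal.
Proof. by rewrite Quotient.idealrBE; split=> [?|/eqP//]; apply/eqP. Qed.

Lemma pi_zmod : zmod_morphism pi.
Proof. exact: raddfB. Qed.
HB.instance Definition _ := GRing.isZmodMorphism.Build _ _ pi pi_zmod.

Definition alg_mul (x y : alg) : alg := pi (repr x * repr y).

Lemma pi_mul p q : pi (p * q) = alg_mul (pi p) (pi q).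
Proof.
apply/pi_eq; set p' := repr (pi p); set q' := repr (pi q).
have Ip : p - p' \in rel_ideal by apply/pi_eq; rewrite pi_repr.
have Iq : q - q' \in rel_ideal by apply/pi_eq; rewrite pi_repr.
have -> : p * q - p' * q' = 1 * (p - p') * q + p' * (q - q') * 1.
  by rewrite mul1r mulr1 mulrBl mulrBr addrA subrK.
by rewrite rpredD ?rel_idealM.
Qed.

Lemma alg_mulA : associative alg_mul.
Proof.
move=> x y z; rewrite -(pi_repr x) -(pi_repr y) -(pi_repr z).
by rewrite -!pi_mul mulrA.
Qed.

Lemma alg_mul1x : left_id (pi 1) alg_mul.
Proof. by move=> x; rewrite -(pi_repr x) -!pi_mul mul1r. Qed.

Lemma alg_mulx1 : right_id (pi 1) alg_mul.
Proof. by move=> x; rewrite -(pi_repr x) -!pi_mul mulr1. Qed.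

Lemma alg_mulDl : left_distributive alg_mul +%R.
Proof.
move=> x y z; rewrite -(pi_repr x) -(pi_repr y) -(pi_repr z).
by rewrite -raddfD -!pi_mul -raddfD mulrDl.
Qed.

Lemma alg_mulDr : right_distributive alg_mul +%R.
Proof.
move=> x y z; rewrite -(pi_repr x) -(pi_repr y) -(pi_repr z).
by rewrite -raddfD -!pi_mul -raddfD mulrDr.
Qed.

Lemma alg_neq0 : pi 1 != 0.
Proof.
apply/eqP; rewrite -(raddf0 pi) => /pi_eq; rewrite subr0 => /rel_ideal_coef1.
by move/eqP; rewrite rmorph1 oner_eq0.
Qed.

HB.instance Definition _ := GRing.Zmodule_isNzRing.Build alg
  alg_mulA alg_mul1x alg_mulx1 alg_mulDl alg_mulDr alg_neq0.

Lemma pi_monoid : monoid_morphism pi.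
Proof. by split=> // p q; rewrite pi_mul. Qed.
HB.instance Definition _ := GRing.isMonoidMorphism.Build _ _ pi pi_monoid.

Definition alg_scale (c : K) (x : alg) : alg := pi (c *: repr x).

Lemma pi_scale c p : pi (c *: p) = alg_scale c (pi p).
Proof.
apply/pi_eq; rewrite -scalerBr -mul_malgC -[X in X \in _]mulr1 rel_idealM //.
by apply/pi_eq; rewrite pi_repr.
Qed.

Lemma alg_scaleA a b x : alg_scale a (alg_scale b x) = alg_scale (a * b) x.
Proof. by rewrite -(pi_repr x) -!pi_scale scalerA. Qed.

Lemma alg_scale1 : left_id 1 alg_scale.
Proof. by move=> x; rewrite -(pi_repr x) -pi_scale scale1r. Qed.

Lemma alg_scaleDr : right_distributive alg_scale +%R.
Proof.
move=> a x y; rewrite -(pi_repr x) -(pi_repr y).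
by rewrite -raddfD -!pi_scale -raddfD scalerDr.
Qed.

Lemma alg_scaleDl x : {morph alg_scale^~ x : a b / a + b}.
Proof. by move=> a b; rewrite -(pi_repr x) -!pi_scale -raddfD scalerDl. Qed.

HB.instance Definition _ := GRing.Zmodule_isLmodule.Build K alg
  alg_scaleA alg_scale1 alg_scaleDr alg_scaleDl.

Lemma alg_scaleAl (a : K) (x y : alg) : a *: (x * y) = (a *: x) * y.
Proof.
have piZ c p : pi (c *: p) = c *: pi p by exact: pi_scale.
by rewrite -(pi_repr x) -(pi_repr y) -rmorphM -!piZ -rmorphM scalerAl.
Qed.

HB.instance Definition _ := GRing.Lmodule_isLalgebra.Build K alg alg_scaleAl.

(* The augmentation, which sends every generator to 0. *)
Definition aug (x : alg) : K := (repr x)@_1%M.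

Lemma aug_pi p : aug (pi p) = p@_1%M.
Proof.
apply/eqP; rewrite -subr_eq0 -raddfB; apply/eqP/rel_ideal_coef1.
by apply/pi_eq; rewrite pi_repr.
Qed.

Lemma aug_zmod : zmod_morphism aug.
Proof.
move=> x y; rewrite -(pi_repr x) -(pi_repr y) -raddfB.
by rewrite !aug_pi raddfB.
Qed.
HB.instance Definition _ := GRing.isZmodMorphism.Build _ _ aug aug_zmod.

Lemma aug_monoid : monoid_morphism aug.
Proof.
split=> [|x y]; first by rewrite aug_pi rmorph1.
by rewrite -(pi_repr x) -(pi_repr y) -rmorphM !aug_pi rmorphM.
Qed.
HB.instance Definition _ := GRing.isMonoidMorphism.Build _ _ aug aug_monoid.

Definition alg_gr (n : nat) : set alg :=
  [set x | exists2 p, homog n p & x = pi p].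

End Quotient.

Definition alg_resolution (A : presentation) := resolution (@alg_gr A) (@aug A).

Definition delta (D i : nat) : nat := (D * i./2 + odd i)%N.

(* Ext does not depend on the resolution P. *)
Definition two_D_determined (A : presentation) (D : nat) : Prop :=
  (exists G : set (free_alg K (gens A)),
     (forall p, G p -> homog 2 p \/ homog D p) /\
     forall p, ideal_gen G p <-> ideal_gen (@rels A) p) /\
  forall (P : alg_resolution A) i j, (delta D i < j)%N -> ext_eq0 P i j.

Definition free_map (X Y : choiceType) (s : X -> Y) (p : free_alg K X) :
    free_alg K Y :=
  \sum_(w <- msupp p) << p@_w *g \big[mmul/1%M]_(x <- w) fmu (s x) >>.

Lemma free_map_homog (X Y : choiceType) (s : X -> Y) n p :
  homog n p -> homog n (free_map s p).
Proof.
move=> hp w; apply: contraPP => /eqP wn; apply/negP.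
rewrite -mcoeff_eq0 raddf_sum /= big_seq big1 // => v /hp vn.
rewrite mcoeffU; case: eqP => // vw; case/negP: wn.
rewrite -vw fdeg_prod -vn fdegE -sum1_size; apply/eqP.
by apply: eq_bigr => x _; rewrite fdegU.
Qed.

Section FreeProduct.
Variables A B : presentation.

Definition free_product_rels : set (free_alg K (gens A + gens B)%type) :=
  ((free_map inl @` @rels A) `|` (free_map inr @` @rels B))%classic.

Lemma free_product_homog p :
  free_product_rels p -> exists2 n, (0 < n)%N & homog n p.
Proof.
by case=> -[q /rels_homog[n n0 hq] <-]; exists n => //; apply: free_map_homog.
Qed.

(* T(V)/I and T(W)/J have free product T(V + W)/(I, J). *)
Definition free_product : presentation := Presentation free_product_homog.
End FreeProduct.

End Presentations.

Section Algebras.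
Variable K : fieldType.

Lemma homogB (X : choiceType) n (p q : free_alg K X) :
  homog n p -> homog n q -> homog n (p - q).
Proof.
by move=> hp hq w /(fsubsetP (msuppB_le _ _)); rewrite in_fsetU => /orP[/hp|/hq].
Qed.

Lemma homogM (X : choiceType) m n (p q : free_alg K X) :
  homog m p -> homog n q -> homog (m + n) (p * q).
Proof.
by move=> hp hq w /msuppM_le[u [v [/hp <- /hq <- ->]]]; rewrite fdegM.
Qed.

Lemma homog_var (X : choiceType) (x : X) : homog 1 (var K x).
Proof. by move=> w; rewrite msuppU1 in_fset1 => /eqP ->; rewrite fdegU. Qed.

Definition A_rels : set (free_alg K 'I_8) :=
  let v i : free_alg K 'I_8 := var K (inord i) in
  let a := v 0%N in let b := v 1%N in let c := v 2%N in let d := v 3%N in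
  let e := v 4%N in let f := v 5%N in let l := v 6%N in let m := v 7%N in
  [set p | p \in [:: b * c - e * f; a * e; d * a - l * m; c * l]]%classic.

Lemma A_rels_homog p : A_rels p -> exists2 n, (0 < n)%N & homog n p.
Proof.
rewrite /A_rels /= => Ap; exists 2 => //; move: Ap; rewrite !inE.
have h2 i j : homog 2 (var K (inord i : 'I_8) * var K (inord j)).
  exact: (homogM (@homog_var _ _) (@homog_var _ _)).
by case/or4P => /eqP ->; try apply: homogB; apply: h2.
Qed.

Definition A_alg : presentation K := Presentation A_rels_homog.

Definition B_rels : set (free_alg K unit) := [set var K tt ^+ 4]%classic.

Lemma B_rels_homog p : B_rels p -> exists2 n, (0 < n)%N & homog n p.
Proof.
move=> ->; exists 4 => //; rewrite !exprS expr0 mulr1.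
by do 3![apply: (@homogM _ 1) => //; first exact: homog_var]; apply: homog_var.
Qed.

Definition B_alg : presentation K := Presentation B_rels_homog.

Definition C_alg : presentation K := free_product A_alg B_alg.

End Algebras.

(* Every presented algebra has a graded projective resolution of K, so the
   quantification over resolutions is not vacuous: P_0 = R, and P_(n+1) is the
   free module on the homogeneous elements of the kernel of the previous map. *)

Section GradingTheory.
Variables (M : zmodType) (gr : nat -> set M).
Hypothesis grM : is_grading gr.

Lemma gradingD j x y : gr j x -> gr j y -> gr j (x + y).
Proof.
move=> hx hy; rewrite -[y]opprK; apply: gradingB => //.
by rewrite -[- y]add0r; apply: gradingB => //; apply: grading0.
Qed.
End GradingTheory.

Lemma gr_span_closed (M : zmodType) (gr : nat -> set M) :
  (forall j, gr j 0) ->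
  (forall j x y, gr j x -> gr j y -> gr j (x + y)) ->
  forall x y,
  (exists n, exists c : nat -> M,
    (forall j, gr j (c j)) /\ x = \sum_(j < n) c j) ->
  (exists n, exists c : nat -> M,
    (forall j, gr j (c j)) /\ y = \sum_(j < n) c j) ->
  exists n, exists c : nat -> M,
    (forall j, gr j (c j)) /\ x + y = \sum_(j < n) c j.
Proof.
move=> g0 gD x y [n [c [hc ->]]] [m [e [he ->]]].
exists (n + m)%N; exists (fun j => (if (j < n)%N then c j else 0) +
  (if (j < m)%N then e j else 0)); split.
  by move=> j; apply: gD; case: ifP.
rewrite big_split /=; congr (_ + _).
  by rewrite (big_ord_widen (n + m) c) ?leq_addr // big_mkcond.
by rewrite (big_ord_widen (n + m) e) ?leq_addl // big_mkcond.
Qed.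

Lemma gr_span1 (M : zmodType) (gr : nat -> set M) k x :
  (forall j, gr j 0) -> gr k x ->
  exists n, exists c : nat -> M,
    (forall j, gr j (c j)) /\ x = \sum_(j < n) c j.
Proof.
move=> g0 hx; exists k.+1, (fun j => if j == k then x else 0); split.
  by move=> j; case: eqP => [->|].
rewrite big_ord_recr /= eqxx big1 ?add0r // => i _.
by rewrite ltn_eqF.
Qed.

Lemma malgZU (R : nzRingType) (B : choiceType) (r : R) (b : B) :
  r *: << 1 *g b >> = << r *g b >> :> {malg R[B]}.
Proof.
apply/malgP => b'; rewrite mcoeffZ !mcoeffU.
by case: eqP => _; rewrite ?mulr1n ?mulr0n ?mulr1 ?mulr0.
Qed.

Section Existence.
Variables (K : fieldType) (R : nzRingType) (gR : nat -> set R).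
Variable aug : {rmorphism R -> K}.
Hypothesis grR : is_grading gR.
Hypothesis gRM : forall i j r s, gR i r -> gR j s -> gR (i + j)%N (r * s).
Hypothesis aug_onto : forall a, exists x : R, aug x = a.
Hypothesis aug_gr : forall j r, gR j r -> (0 < j)%N -> aug r = 0.

Definition graded_sub (M : lmodType R) (gr : nat -> set M) (S : set M) : Prop :=
  [/\ S 0, forall (r : R) x y, S x -> S y -> S (r *: x + y)
    & forall n (c : nat -> M), (forall j, gr j (c j)) ->
      S (\sum_(j < n) c j) -> forall j, (j < n)%N -> S (c j)].

Section FreeCover.
Variables (M : lmodType R) (gr : nat -> set M) (S : set M).
Hypothesis grM : is_graded_module gR gr.
Hypothesis grS : graded_sub gr S.

Definition fc_gen := {x : M * nat | `[< gr x.2 x.1 /\ S x.1 >]}.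
Definition fc_val (b : fc_gen) : M := (val b).1.
Definition fc_deg (b : fc_gen) : nat := (val b).2.

Lemma fc_val_gr b : gr (fc_deg b) (fc_val b).
Proof. by have /asboolP[] := valP b. Qed.

Lemma fc_valS b : S (fc_val b).
Proof. by have /asboolP[] := valP b. Qed.

Definition fc_mod : lmodType R := {malg R[fc_gen]}.

Definition fc_ext (N : lmodType R) (v : fc_gen -> N) (g : fc_mod) : N :=
  \sum_(b <- msupp g) g@_b *: v b.

Lemma fc_extEw (N : lmodType R) (v : fc_gen -> N) (d : {fset fc_gen}) g :
  (msupp g `<=` d)%fset -> fc_ext v g = \sum_(b <- d) g@_b *: v b.
Proof.
move=> le; rewrite /fc_ext (big_fset_incl _ le) //= => b _ /mcoeff_outdom ->.
by rewrite scale0r.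
Qed.

Lemma fc_ext_linear (N : lmodType R) (v : fc_gen -> N) : linear (fc_ext v).
Proof.
move=> r g h; pose d := (msupp g `|` msupp h)%fset.
rewrite (@fc_extEw _ _ d) ?(@fc_extEw _ _ d g) ?(@fc_extEw _ _ d h).
- rewrite scaler_sumr -big_split /=; apply: eq_bigr => b _.
  by rewrite mcoeffD mcoeffZ scalerDl scalerA.
- exact: fsubsetUr.
- exact: fsubsetUl.
- apply: fsubset_trans (msuppD_le _ _) _.
  by apply: fsetSU; apply: msuppZ_le.
Qed.
HB.instance Definition _ (N : lmodType R) (v : fc_gen -> N) :=
  GRing.isLinear.Build R fc_mod N *:%R (fc_ext v) (fc_ext_linear v).

Lemma fc_extU (N : lmodType R) (v : fc_gen -> N) r b :
  fc_ext v << r *g b >> = r *: v b.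
Proof.
by rewrite (@fc_extEw _ v [fset b]%fset) ?msuppU_le // big_seq_fset1 mcoeffUU.
Qed.

Definition fc_map : {linear fc_mod -> M} := fc_ext fc_val.

Lemma fc_mapS g : S (fc_map g).
Proof.
case: grS => S0 SL _; rewrite /fc_map /= /fc_ext.
elim: (enum_fset (msupp g)) => [|b s IH]; first by rewrite big_nil.
by rewrite big_cons; apply: SL => //; apply: fc_valS.
Qed.

Lemma fc_map_onto x : S x -> exists g, x = fc_map g.
Proof.
case: grS => S0 SL Sc Sx; have [gM _] := grM.
have [n [c [hc xE]]] := grading_span gM x.
have cS j : (j < n)%N -> S (c j) by apply: Sc => //; rewrite -xE.
rewrite xE; elim: n {xE} cS => [_|n IH cS].
  by exists 0; rewrite big_ord0 raddf0.
have [|g gE] := IH; first by move=> j jn; apply: cS; apply: ltnW.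
have hb : `[< gr (c n, n).2 (c n, n).1 /\ S (c n, n).1 >].
  by apply/asboolP; split; [apply: hc|apply: cS].
exists (g + << 1 *g (exist _ (c n, n) hb : fc_gen) >>).
rewrite big_ord_recr /= gE linearD; congr (_ + _).
by rewrite /fc_map /= fc_extU scale1r.
Qed.

Definition fc_gr (j : nat) : set fc_mod := fun g =>
  forall b, if (fc_deg b <= j)%N then gR (j - fc_deg b) g@_b else g@_b = 0.

Lemma fc_graded : is_graded_module gR fc_gr.
Proof.
have gR0 := grading0 grR; split; first split.
- by move=> j b; rewrite mcoeff0; case: ifP => // _; apply: gR0.
- move=> j g h hg hh b; rewrite mcoeffB; move: (hg b) (hh b).
  by case: ifP => [_|_ -> ->]; [apply: gradingB|rewrite subrr].
- have F0 : forall j, fc_gr j 0.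
    by move=> j b; rewrite mcoeff0; case: ifP => // _; apply: gR0.
  have FD : forall j x y, fc_gr j x -> fc_gr j y -> fc_gr j (x + y).
    move=> j g h hg hh b; rewrite mcoeffD; move: (hg b) (hh b).
    by case: ifP => [_|_ -> ->]; [apply: gradingD|rewrite addr0].
  have F1 j r b : gR j r -> fc_gr (j + fc_deg b) << r *g b >>.
    move=> hr b'; rewrite mcoeffU; case: eqP => [<-|_].
      by rewrite leq_addl addnK.
    by case: ifP => // _; apply: gR0.
  move=> g; rewrite (monalgE g).
  elim: (enum_fset (msupp g)) => [|b s IH].
    by rewrite big_nil; apply: (@gr_span1 _ fc_gr 0).
  rewrite big_cons; apply: gr_span_closed IH => //.
  have [n [c [hc ->]]] := grading_span grR (g@_b).
  rewrite raddf_sum /=; elim: n => [|n IH].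
    by rewrite big_ord0; apply: (@gr_span1 _ fc_gr 0).
  rewrite big_ord_recr /=; apply: gr_span_closed => //.
  exact: (gr_span1 F0 (F1 _ _ _ (hc n))).
- move=> n c hc c0 j jn; apply/malgP => b; rewrite mcoeff0.
  have := hc j b; case: ifP => // bj _.
  pose e k := if (k + fc_deg b < n)%N then (c (k + fc_deg b)%N)@_b else 0.
  have he k : gR k (e k).
    rewrite /e; case: ifP => // _.
    by have := hc (k + fc_deg b)%N b; rewrite leq_addl addnK.
  have e0 : \sum_(k < n - fc_deg b) e k = 0.
    have bn : (fc_deg b <= n)%N by apply: leq_trans (ltnW jn).
    have := congr1 (mcoeff b) c0; rewrite mcoeff0 raddf_sum /=.
    rewrite -(big_mkord xpredT (fun j => (c j)@_b)).
    rewrite (big_cat_nat _ bn) //= big_nat big1 => [|i /andP[_ ib]].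
      rewrite add0r -{1}[fc_deg b]add0n big_addn big_mkord => bE.
      rewrite -[RHS]bE; apply: eq_bigr => -[k kn] _ /=.
      by rewrite /e addnC -ltn_subRL kn addnC.
    by have := hc i b; rewrite leqNgt ib.
  have jb : (j - fc_deg b < n - fc_deg b)%N by rewrite ltn_sub2r // (leq_ltn_trans bj).
  by have := grading_indep grR he e0 jb; rewrite /e subnK // jn.
- move=> i j r g hr hg b; rewrite mcoeffZ; have := hg b.
  case: ifP => bj.
    by rewrite (leq_trans bj (leq_addl _ _)) -addnBA // => h; apply: gRM.
  move=> ->; rewrite mulr0; case: ifP => // _; exact: gR0.
Qed.

Lemma fc_proj : projective fc_mod.
Proof.
move=> X Y p f p_onto.
have /choice[v hv] b : exists x, p x = f << 1 *g b >> by apply: p_onto.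
exists (fc_ext v) => g /=; rewrite {2}(monalgE g) /fc_ext !raddf_sum.
apply: eq_bigr => b _ /=; rewrite linearZ /= hv -linearZ; congr (f _).
exact: malgZU.
Qed.

Lemma fc_map_gr j g : fc_gr j g -> gr j (fc_map g).
Proof.
move=> hg; have [gM grZ] := grM; rewrite /fc_map /= /fc_ext.
elim: (enum_fset (msupp g)) => [|b s IH].
  by rewrite big_nil; apply: grading0.
rewrite big_cons; apply: gradingD => //; have := hg b; case: ifP => bj hb.
  by rewrite -(subnK bj); apply: grZ => //; apply: fc_val_gr.
by rewrite hb scale0r; apply: grading0.
Qed.

Lemma fc_ker_sub : graded_sub fc_gr [set g | fc_map g = 0]%classic.
Proof.
split=> [|r x y hx hy|n c hc c0 j jn].
- exact: linear0.
- by rewrite /mkset linearP hx hy scaler0 addr0.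
have [gM _] := grM; apply: (grading_indep gM (c := fun j => fc_map (c j))) jn.
  by move=> k; apply: fc_map_gr.
by rewrite -raddf_sum.
Qed.
End FreeCover.

Record stage := Stage {
  st_mod : lmodType R;
  st_gr : nat -> set st_mod;
  st_sub : set st_mod;
  st_graded : is_graded_module gR st_gr;
  st_gsub : graded_sub st_gr st_sub }.

Definition next (s : stage) : stage :=
  Stage (fc_graded (@st_gr s) (@st_sub s))
        (fc_ker_sub (@st_sub s) (st_graded s)).

Lemma R_graded : @is_graded_module R gR R^o gR.
Proof. by split=> // i j r x; apply: gRM. Qed.

Definition eps (x : R^o) : K := aug x.
Lemma eps_linear : linear_for (aug \; *%R) eps.
Proof. by move=> r x y; rewrite /eps rmorphD rmorphM. Qed.
HB.instance Definition _ :=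
  GRing.isLinear.Build R R^o K (aug \; *%R) eps eps_linear.

Lemma eps_gr j x : gR j x -> (0 < j)%N -> eps x = 0.
Proof. exact: aug_gr. Qed.

Lemma eps_sub : @graded_sub R^o gR [set x | eps x = 0]%classic.
Proof.
split=> [|r x y /= hx hy|n c hc /= c0 j jn].
- by rewrite /= raddf0.
- by rewrite linearP /= hx hy mulr0 addr0.
case: j jn => [|j] jn; last exact: eps_gr (hc _) _.
case: n c0 jn => // n; rewrite big_ord_recl raddfD raddf_sum /= big1 ?addr0 //.
by move=> i _; apply: eps_gr (hc _) _.
Qed.

Lemma R_proj : projective (R^o : lmodType R).
Proof.
move=> X Y p f p_onto; have [x xE] := p_onto (f 1).
pose g (r : R^o) := r *: x.
have g_linear : linear g.
  by move=> r s t; rewrite /g scalerDl scalerA.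
pose gL := GRing.isLinear.Build R R^o X *:%R g g_linear.
pose gl : {linear R^o -> X} := HB.pack g gL.
exists gl => r; rewrite /= /g linearZ /= xE -linearZ; congr (f _).
exact: mulr1.
Qed.

Fixpoint stages n := if n is n'.+1 then next (stages n') else
  Stage R_graded eps_sub.

Theorem resolution_exists : inhabited (resolution gR aug).
Proof.
constructor.
apply: (@Resolution K R gR aug (fun n => st_mod (stages n))
  (fun n => @st_gr (stages n))
  (fun n => fc_map (@st_gr (stages n)) (@st_sub (stages n))) eps).
- by move=> n; apply: st_graded.
- by case=> [|n]; [apply: R_proj|apply: fc_proj].
- by move=> n j x; apply: fc_map_gr; exact: st_graded.
- exact: eps_gr.
- move=> a; have [x xE] : exists x : R, aug x = a by exact: aug_onto.
  by exists x.
- move=> x; split; first exact: (fc_map_onto R_graded eps_sub).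
  by case=> y ->; exact: (fc_mapS eps_sub).
- move=> n x; split; first exact: (fc_map_onto (st_graded _) (st_gsub (stages n.+1))).
  by case=> y ->; exact: (fc_mapS (st_gsub (stages n.+1))).
Qed.
End Existence.

Section AlgGrading.
Variables (K : fieldType).

Fact hcomp_subproof (X : choiceType) (j : nat) (p : free_alg K X) :
  {q : free_alg K X | forall w, q@_w = if fdeg w == j then p@_w else 0}.
Proof.
exists (\sum_(w <- msupp p | fdeg w == j) << p@_w *g w >>) => w.
rewrite raddf_sum /= big_mkcond /=.
rewrite (eq_bigr (fun v => if fdeg w == j then << p@_v *g v >>@_w else 0)).
  by case: ifP => _; [rewrite -raddf_sum -monalgE|rewrite big1].
move=> v _; rewrite mcoeffU; have [->//|_] := eqVneq v w.
by rewrite mulr0n !if_same.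
Qed.

Definition hcomp (X : choiceType) j (p : free_alg K X) : free_alg K X :=
  sval (hcomp_subproof j p).

Lemma hcompE (X : choiceType) j (p : free_alg K X) w :
  (hcomp j p)@_w = if fdeg w == j then p@_w else 0.
Proof. exact: svalP (hcomp_subproof j p) w. Qed.

Lemma hcomp_zmod (X : choiceType) j : zmod_morphism (@hcomp X j).
Proof.
move=> p q; apply/malgP => w.
rewrite [RHS]mcoeffB !hcompE.
by case: ifP => _; rewrite ?mcoeffB // subr0.
Qed.
HB.instance Definition _ X j :=
  GRing.isZmodMorphism.Build _ _ (@hcomp X j) (@hcomp_zmod X j).

Lemma hcomp_homog (X : choiceType) j (p : free_alg K X) : homog j (hcomp j p).
Proof.
by move=> w; rewrite -mcoeff_neq0 hcompE; case: (fdeg w =P j); rewrite ?eqxx.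
Qed.

Lemma hcomp_id (X : choiceType) j (p : free_alg K X) :
  homog j p -> hcomp j p = p.
Proof.
move=> hp; apply/malgP => w; rewrite hcompE; case: eqP => // wj.
by case: msuppP => // /hp.
Qed.

Lemma hcomp_neq (X : choiceType) i j (p : free_alg K X) :
  homog i p -> i <> j -> hcomp j p = 0.
Proof.
move=> hp ij; apply/malgP => w; rewrite hcompE mcoeff0; case: eqP => // wj.
by case: msuppP => // /hp wi; case: ij; rewrite -wi.
Qed.

Lemma homog0 (X : choiceType) j : homog j (0 : free_alg K X).
Proof. by move=> w; rewrite msupp0 in_fset0. Qed.

Lemma homogU (X : choiceType) (a : K) (w : {fmonom X}) :
  homog (fdeg w) << a *g w >>.
Proof. by move=> v /(fsubsetP msuppU_le); rewrite in_fset1 => /eqP->. Qed.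

Lemma hcomp_sum (X : choiceType) (p : free_alg K X) :
  p = \sum_(j < mmeasure (@fdeg X) p) hcomp j p.
Proof.
apply/malgP => w; rewrite raddf_sum /=.
have [wp|wp] := msuppP.
  rewrite (bigD1 (Ordinal (mmeasure_mnm_lt (@fdeg X) wp))) //= hcompE eqxx.
  rewrite big1 ?addr0 // => j; rewrite -val_eqE /= eq_sym => /negPf jw.
  by rewrite hcompE jw.
by rewrite big1 // => j _; rewrite hcompE (mcoeff_outdom wp) if_same.
Qed.

Lemma homog_ind (X : choiceType) (Q : free_alg K X -> Prop) :
  Q 0 -> (forall p q, Q p -> Q q -> Q (p + q)) ->
  (forall n p, homog n p -> Q p) -> forall p, Q p.
Proof.
move=> Q0 QD Qh p; rewrite (hcomp_sum p); elim/big_ind: _ => // j _.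
exact/Qh/hcomp_homog.
Qed.

Variable A : presentation K.

Lemma rel_ideal_hcomp p : p \in @rel_ideal K A ->
  forall j, hcomp j p \in @rel_ideal K A.
Proof.
move=> /rel_idealP; elim=> {p} [p rp||p q _ Ip _ Iq|u v p _ Ip] j.
- have [n _ hp] := rels_homog rp; have [<-|/eqP nj] := eqVneq n j.
    by rewrite hcomp_id //; apply/rel_idealP/IdealGen.
  by rewrite (hcomp_neq hp nj) rpred0.
- by rewrite raddf0 rpred0.
- by rewrite raddfB; apply: rpredB; [exact: Ip|exact: Iq].
elim/homog_ind: u => [|u u' hu hu'|m u hu].
- by rewrite mul0r mul0r raddf0 rpred0.
- have -> : (u + u') * p * v = u * p * v + u' * p * v.
    exact: etrans (congr1 ( *%R^~ v) (mulrDl u u' p)) (mulrDl _ _ v).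
  by rewrite (raddfD (hcomp j)); apply: rpredD; [exact: hu|exact: hu'].
elim/homog_ind: v => [|v v' hv hv'|n v hv].
- by rewrite mulr0 raddf0 rpred0.
- have -> : u * p * (v + v') = u * p * v + u * p * v' by exact: mulrDr.
  by rewrite (raddfD (hcomp j)); apply: rpredD; [exact: hv|exact: hv'].
rewrite [X in _ * X * _](hcomp_sum p) mulr_sumr mulr_suml raddf_sum.
apply: rpred_sum => k _ /=.
have h : homog (m + k + n) (u * hcomp k p * v).
  by apply: homogM hv; apply: homogM hu _; apply: hcomp_homog.
have [<-|/eqP nj] := eqVneq (m + k + n)%N j.
  by rewrite hcomp_id //; apply: rel_idealM; apply: Ip.
by rewrite (hcomp_neq h nj) rpred0.
Qed.

Lemma alg_grading : is_grading (@alg_gr K A).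
Proof.
split=> [j|j x y [p hp ->] [q hq ->]|x|n c hc c0 j jn].
- by exists 0; [apply: homog0|rewrite raddf0].
- by exists (p - q); [apply: homogB|rewrite raddfB].
- rewrite -(pi_repr x) (hcomp_sum (repr x)) raddf_sum.
  exists (mmeasure (@fdeg (gens A)) (repr x)).
  exists (fun j => pi (hcomp j (repr x))); split=> // j.
  by exists (hcomp j (repr x)) => //; apply: hcomp_homog.
have /choice[t ht] k : exists p, homog k p /\ c k = pi p.
  by have [p ? ?] := hc k; exists p.
have : \sum_(k < n) t k \in @rel_ideal K A.
  rewrite -[X in X \in _]subr0; apply/pi_eq; rewrite raddf0 raddf_sum -[RHS]c0.
  by apply: eq_bigr => k _; rewrite (ht k).2.
move=> /rel_ideal_hcomp/(_ j); rewrite raddf_sum /= (bigD1 (Ordinal jn)) //=.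
rewrite (hcomp_id (ht j).1) big1 => [|k kj]; last first.
  by apply: hcomp_neq (ht k).1 _ => kE; case/eqP: kj; apply: val_inj.
rewrite addr0 => tI; rewrite (ht j).2 -(raddf0 (@pi K A)); apply/pi_eq.
by rewrite subr0.
Qed.

Lemma alg_resolution_exists : inhabited (alg_resolution A).
Proof.
apply: resolution_exists => [|i j r s [p hp ->] [q hq ->]|a|j r [p hp ->] j0].
- exact: alg_grading.
- by exists (p * q); [apply: homogM|rewrite rmorphM].
- by exists (@pi K A (malgC a)); rewrite /= aug_pi malgCK.
rewrite /= aug_pi; apply: mcoeff_outdom; apply/negP => /hp; rewrite fdeg1 => jE.
by rewrite -jE in j0.
Qed.
End AlgGrading.

(* Main.v *)
Require Import Defs.
From mathcomp Require Import all_boot all_algebra.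
From HB Require Import structures.
From mathcomp Require Import boolp classical_sets.
From mathcomp Require Import finmap monalg.
From mathcomp Require Import zify.

(* In an algebra presented by generators and relations, the left syzygies of
   the generators are generated by the Fox Jacobian of the relations.  Reading
   off the coordinates of a syzygy with a single nonzero entry, one gets in C,
   without normal forms, the left annihilators: 0 for b and d, C cd for a,
   C ab for c, C z^3 for z and C z for z^3.  This is all that is needed to
   write down the minimal resolution of K over C: in each homological degree
   n >= 3 it has three generators, two in internal degree 2n - 2 on which the
   differential is multiplication by ab and cd alternately, and one in degree
   delta 4 n on which it is multiplication by z and z^3 alternately.  The
   internal degrees show that C is 2-4-determined.

   Let u_n be a generator of internal degree 2n - 2 and H a chain endomorphism
   of the minimal resolution of cohomological degree strictly between 0 and n.
   Since d u_n is x u_(n-1) with x = ab or x = cd, the boundary of H(u_n) is x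
   times H(u_(n-1)).  Inductively the latter has coefficients in C_+, hence so
   does H(u_n): if p is a coefficient of H(u_n), then p times one of ab, cd, z,
   z^3 is in x C_+, so p has no constant term.  Thus the class dual to u_n is
   indecomposable for all n >= 3. *)

Set Implicit Arguments.
Unset Strict Implicit.
Unset Printing Implicit Defensive.

Import GRing.Theory.

Local Open Scope ring_scope.
Local Notation "1" := (@mone _) : monom_scope.
Local Notation pi := Defs.pi.

(** * Fox calculus *)

Section FreeAlgebra.
Variables (K : fieldType) (X : choiceType).
Local Notation T := (free_alg K X).
Implicit Types (p q : T) (x v : X).

Lemma mulUU (c d : K) (u w : {fmonom X}) :
  << c *g u >> * << d *g w >> = << c * d *g mmul u w >> :> T.
Proof.
rewrite (malgMEw (msuppU_le) (msuppU_le)) !big_seq_fset1.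
by rewrite !mcoeffUU.
Qed.

Lemma free_alg_ind (Q : T -> Prop) :
  Q 0 -> (forall p q, Q p -> Q q -> Q (p + q)) ->
  (forall c : K, Q c%:MP) -> (forall p x, Q p -> Q (p * var K x)) ->
  forall p, Q p.
Proof.
move=> Q0 QD QC QM p; rewrite (monalgE p); elim/big_ind: _ => // w _.
move: (p@_w) => c; case: w => w; elim/last_ind: w => [|w x IH].
  by rewrite -(fmoneE X); apply: QC.
suff -> : << c *g FMonom (rcons w x) >> = << c *g FMonom w >> * var K x.
  exact: QM.
rewrite mulUU mulr1; congr << _ *g _ >>.
by apply/eqP; rewrite fmP fmM fmU cats1.
Qed.

Lemma malgC_comm (c : K) p : c%:MP * p = p * c%:MP.
Proof.
rewrite (monalgE p) mulr_sumr mulr_suml; apply: eq_bigr => w _.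
by rewrite !mulUU mul1m mulm1 mulrC.
Qed.

Lemma mcoeff1_var x : (var K x)@_1%M = 0.
Proof. by rewrite mcoeffU1 fm1_eq1. Qed.

Definition fox_word v (w : {fmonom X}) : T :=
  if rev w is x :: s then if x == v then << FMonom (rev s) >> else 0 else 0.

(* [fox v p] is the left cofactor of the final letter [v] in [p]. *)
Definition fox v : T -> T := mmap (@malgC {fmonom X} K) (fox_word v).
HB.instance Definition _ v := GRing.Additive.on (fox v).

Lemma foxC v c : fox v c%:MP = 0.
Proof. by rewrite /fox mmapU /fox_word fm1 mulr0. Qed.

Lemma foxMvar v p x : fox v (p * var K x) = if x == v then p else 0.
Proof.
rewrite [in LHS](monalgE p) mulr_suml raddf_sum /=.
rewrite (eq_bigr (fun w => if x == v then << p@_w *g w >> else 0)) => [|w _].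
  by case: eqP => _; rewrite -?monalgE // big1.
rewrite mulUU mulr1 /fox mmapU /fox_word fmM fmU rev_cat /=.
case: eqP => _; last by rewrite mulr0.
by rewrite mulUU mulr1 mul1m revK fmK.
Qed.

End FreeAlgebra.

(** * Fox derivatives and the left syzygies of the generators of a quotient *)

Section FoxCalculus.
Variables (K : fieldType) (T R : nzRingType) (X I : finType).
Variables (x : X -> T) (C : {rmorphism K -> T}) (eps : {rmorphism T -> K}).
Variable D : X -> {additive T -> T}.
Hypothesis T_ind : forall Q : T -> Prop,
  Q 0 -> (forall p q, Q p -> Q q -> Q (p + q)) ->
  (forall c, Q (C c)) -> (forall p v, Q p -> Q (p * x v)) -> forall p, Q p.
Hypothesis C_comm : forall c p, C c * p = p * C c.
Hypothesis epsC : forall c, eps (C c) = c.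
Hypothesis epsx : forall v, eps (x v) = 0.
Hypothesis DC : forall v c, D v (C c) = 0.
Hypothesis DMx : forall v p u, D v (p * x u) = if u == v then p else 0.

(** The final letter of a product of words comes from the second factor, unless that factor is a
    constant. So [D v] is a derivation twisted on the right by [eps]. *)
Lemma derivM v p q : D v (p * q) = p * D v q + D v p * C (eps q).
Proof.
elim/T_ind: q => [|q q' IH IH'|c|q u IH].
- by rewrite mulr0 !raddf0 !mulr0 addr0.
- by rewrite mulrDr !raddfD /= IH IH' !mulrDr addrACA.
(* For constant [q] the claim is linearity over the constants, which takes a second induction, on
   [p]. *)
- rewrite DC mulr0 add0r epsC; elim/T_ind: p => [|p p' IH IH'|d|p u _].
  + by rewrite mul0r !raddf0 mul0r.
  + by rewrite mulrDl !raddfD /= IH IH' mulrDl.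
  + by rewrite -rmorphM !DC mul0r.
  + rewrite -mulrA -C_comm mulrA !DMx.
    by case: eqP; rewrite ?mul0r.
- rewrite mulrA !DMx rmorphM /= epsx mulr0 raddf0 mulr0 addr0.
  by case: eqP; rewrite ?mulr0.
Qed.

Lemma deriv_sum (P : X -> T) v : D v (\sum_u P u * x u) = P v.
Proof.
rewrite raddf_sum (bigD1 v) //= DMx eqxx big1 ?addr0 // => u uv.
by rewrite DMx (negPf uv).
Qed.

(** Fundamental formula of Fox calculus: an element is sorted by the final letters of its words. *)
Lemma derivE p : p = C (eps p) + \sum_u D u p * x u.
Proof.
elim/T_ind: p => [|p q IH IH'|c|p u IH].
- by rewrite !raddf0 big1 ?addr0 // => u _; rewrite raddf0 mul0r.
- rewrite {1}IH {1}IH' !raddfD /= addrACA; congr (_ + _).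
  by rewrite -big_split; apply: eq_bigr => u _; rewrite raddfD /= mulrDl.
- by rewrite epsC big1 ?addr0 // => u _; rewrite DC mul0r.
- rewrite rmorphM /= epsx mulr0 raddf0 add0r (bigD1 u) //= DMx eqxx.
  by rewrite big1 ?addr0 // => v vu; rewrite DMx eq_sym (negPf vu) mul0r.
Qed.

Variables (rel : I -> T) (f : {rmorphism T -> R}) (r : R -> T).
Hypothesis fK : cancel r f.
Hypothesis f_ind : forall Q : T -> Prop,
  (forall i, Q (rel i)) -> Q 0 -> (forall p q, Q p -> Q q -> Q (p - q)) ->
  (forall u p v, f p = 0 -> eps p = 0 -> Q p -> Q (u * p * v)) ->
  forall p, f p = 0 -> Q p.

(** For [p] killed by [f] and [eps], the product rule for [u * p * w] loses its terms in [D v w] and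
    [D v u] under [f]. What remains is [f (D v p)] times [f u] on the left and the constant [eps w]
    on the right, and that constant can be moved into the coefficient. *)
Lemma deriv_ideal p : f p = 0 ->
  exists t : I -> R, forall v, f (D v p) = \sum_i t i * f (D v (rel i)).
Proof.
move: p; apply: f_ind => [i||p q [t tE] [s sE]|u p w fp0 ep0 [t tE]].
- exists (fun j => (j == i)%:R) => v.
  rewrite (bigD1 i) //= eqxx mul1r big1 ?addr0 // => j /negPf ->.
  by rewrite mul0r.
- by exists (fun _ => 0) => v; rewrite !raddf0 big1 // => i _; rewrite mul0r.
- exists (fun i => t i - s i) => v; rewrite !raddfB /= tE sE -sumrB.
  by apply: eq_bigr => i _; rewrite mulrBl.
exists (fun i => f u * t i * f (C (eps w))) => v.
rewrite !derivM !raddfD /= !rmorphM fp0 ep0 !raddf0 !mulr0 mul0r add0r addr0.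
rewrite rmorphM tE mulr_sumr mulr_suml; apply: eq_bigr => i _.
by rewrite -!mulrA -!rmorphM C_comm.
Qed.

(** Lifting the coefficients of the syzygy along [r] gives an element of the kernel of [f] whose
    derivatives are the lifted coefficients, so [deriv_ideal] applies. *)
Lemma deriv_syzygy (y : X -> R) : \sum_v y v * f (x v) = 0 ->
  exists t : I -> R, forall v, y v = \sum_i t i * f (D v (rel i)).
Proof.
move=> y0; have [|t tE] := @deriv_ideal (\sum_v r (y v) * x v).
  rewrite raddf_sum -[RHS]y0; apply: eq_bigr => v _.
  by rewrite /= rmorphM fK.
by exists t => v; rewrite -tE deriv_sum fK.
Qed.

Lemma deriv_rel i : f (rel i) = 0 -> eps (rel i) = 0 ->
  \sum_v f (D v (rel i)) * f (x v) = 0.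
Proof.
move=> fi ei; have := congr1 f (derivE (rel i)).
rewrite fi ei raddf0 add0r raddf_sum => E; rewrite [RHS]E.
by apply: eq_bigr => v _; rewrite /= rmorphM.
Qed.

Lemma deriv_span y : eps (r y) = 0 ->
  exists z : X -> R, y = \sum_v z v * f (x v).
Proof.
move=> y0; exists (fun v => f (D v (r y))).
have := congr1 f (derivE (r y)).
rewrite fK y0 raddf0 add0r raddf_sum => E; rewrite [LHS]E.
by apply: eq_bigr => v _; rewrite /= rmorphM.
Qed.

End FoxCalculus.

Section PresentedAlgebra.
Variables (K : fieldType) (A : presentation K) (I : finType).
Variable rel : I -> free_alg K (gens A).
Hypothesis relP : forall p, @rels K A p <-> exists i, p = rel i.
Local Notation pi := (@pi K A).

Definition jac (i : I) (v : gens A) : alg A := pi (fox v (rel i)).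

Lemma pi_eq0 p : pi p = 0 <-> p \in @rel_ideal K A.
Proof. by rewrite -(raddf0 pi) -[X in X \in _]subr0; exact: pi_eq. Qed.

(** Induction over the ideal, strengthened in the multiplication step by the two vanishing facts
    that the twisted product rule uses. *)
Lemma pi_eq0_ind (Q : free_alg K (gens A) -> Prop) :
  (forall i, Q (rel i)) -> Q 0 -> (forall p q, Q p -> Q q -> Q (p - q)) ->
  (forall u p v, pi p = 0 -> p@_1%M = 0 -> Q p -> Q (u * p * v)) ->
  forall p, pi p = 0 -> Q p.
Proof.
move=> Qrel Q0 QB QM p /pi_eq0/rel_idealP.
elim=> {p} [p /relP[i ->]||p q _ Qp _ Qq|u v p Ip Qp] //; first exact: QB.
have {}Ip : p \in @rel_ideal K A by apply/rel_idealP.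
by apply: QM => //; [exact/pi_eq0|exact: rel_ideal_coef1].
Qed.

Definition mcoeff_unit : {rmorphism free_alg K (gens A) -> K} := mcoeff 1%M.

Lemma gens_syzygy (y : gens A -> alg A) :
  \sum_v y v * pi (var K v) = 0 ->
  exists t : I -> alg A, forall v, y v = \sum_i t i * jac i v.
Proof.
apply: (@deriv_syzygy K (free_alg K (gens A)) (alg A) (gens A) I
  (var K (X := gens A)) (@malgC _ K) mcoeff_unit (@fox K (gens A))
  (@free_alg_ind K (gens A)) (@malgC_comm K (gens A)) (@malgCK _ K)
  (@mcoeff1_var K (gens A)) (@foxC K (gens A)) (@foxMvar K (gens A))
  rel pi _ (@pi_repr K A) pi_eq0_ind).
Qed.

Lemma jac_syzygy i : \sum_v jac i v * pi (var K v) = 0.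
Proof.
have ri : rels (rel i) by apply/relP; exists i.
have Ii : rel i \in @rel_ideal K A by apply/rel_idealP/IdealGen.
apply: (@deriv_rel K (free_alg K (gens A)) (alg A) (gens A) I
  (var K (X := gens A)) (@malgC _ K) mcoeff_unit (@fox K (gens A))
  (@free_alg_ind K (gens A)) (@malgCK _ K)
  (@mcoeff1_var K (gens A)) (@foxC K (gens A)) (@foxMvar K (gens A))
  rel pi).
  exact/pi_eq0.
exact: rel_ideal_coef1.
Qed.

Lemma gens_span (x : alg A) : aug x = 0 ->
  exists y : gens A -> alg A, x = \sum_v y v * pi (var K v).
Proof.
move=> x0.
apply: (@deriv_span K (free_alg K (gens A)) (alg A) (gens A)
  (var K (X := gens A)) (@malgC _ K) mcoeff_unit (@fox K (gens A))
  (@free_alg_ind K (gens A)) (@malgCK _ K)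
  (@mcoeff1_var K (gens A)) (@foxC K (gens A)) (@foxMvar K (gens A))
  pi _ (@pi_repr K A)).
exact: x0.
Qed.

Lemma pi_malgC_comm c (x : alg A) : pi c%:MP * x = x * pi c%:MP.
Proof. by rewrite -(pi_repr x) -!rmorphM malgC_comm. Qed.

Lemma aug_malgC c : aug (pi c%:MP) = c.
Proof. by rewrite aug_pi malgCK. Qed.

End PresentedAlgebra.

(** * Lifting and gradings *)

(** Used to build maps degree by degree: [Q] is the invariant that makes the next choice possible,
    [S] the relation tying it to the previous one. *)
Lemma dependent_choice (T : nat -> Type) (Q : forall n, T n -> Prop)
    (S : forall n, T n -> T n.+1 -> Prop) (t0 : T 0%N) :
  Q 0%N t0 -> (forall n t, Q n t -> exists2 t', Q n.+1 t' & S n t t') ->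
  exists t : forall n, T n, [/\ t 0%N = t0, forall n, Q n (t n) &
    forall n, S n (t n) (t n.+1)].
Proof.
move=> Q0 QS.
have step n (t : {t | Q n t}) :
    {t' : {t' | Q n.+1 t'} | S n (sval t) (sval t')}.
  have /cid2[t' Qt' St'] := QS n _ (svalP t).
  by exists (exist _ t' Qt').
pose f := fix f n := if n is m.+1 return {t | Q n t} then sval (step m (f m))
  else exist _ t0 Q0.
exists (fun n => sval (f n)); split=> // n; first exact: svalP.
exact: svalP (step n (f n)).
Qed.

Section Lifting.
Variable R : nzRingType.

(* A projective module is a retract of the free module on its elements, and
   out of a free module lifts can be chosen on the basis. *)
Lemma projective_lift (X N : lmodType R) (Z : zmodType) (s : R -> Z -> Z)
    (f : {linear X -> Z | s}) (p : {linear N -> Z | s}) :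
  projective X -> (forall x, exists y, p y = f x) ->
  exists g : {linear X -> N}, forall x, p (g x) = f x.
Proof.
move=> projX /choice[v vE].
(* With trivial predicates [fc_mod] is free on all pairs of an element of [X] and an index, so it
   maps onto [X]. *)
pose top (_ : nat) : set X := setT.
pose q : {linear fc_mod top setT -> X} := fc_map top setT.
have q_onto y : exists x, q x = y.
  have ty : `[< top (y, 0%N).2 (y, 0%N).1 /\ (setT : set X) (y, 0%N).1 >].
    by apply/asboolP.
  exists << 1 *g (exist _ (y, 0%N) ty : fc_gen top setT) >>.
  by rewrite /q /fc_map /= fc_extU scale1r.
have [sec secK] := projX _ _ q idfun q_onto.
pose g : {linear fc_mod top setT -> N} := fc_ext (fun b => v (fc_val b)).
exists (g \o sec) => x /=; rewrite -[X in _ = f X](secK x).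
rewrite /g /q /fc_map /= /fc_ext !raddf_sum; apply: eq_bigr => b _ /=.
by rewrite !linearZ_LR vE.
Qed.

Section Complexes.
Variables X Y : nat -> lmodType R.
Variable dX : forall n, {linear X n.+1 -> X n}.
Variable dY : forall n, {linear Y n.+1 -> Y n}.
Hypothesis projX : forall n, projective (X n).
Hypothesis dX2 : forall n x, dX n (dX n.+1 x) = 0.
Hypothesis exactY : forall n y, dY n y = 0 -> exists z, y = dY n.+1 z.

(** Comparison theorem. The invariant is that the current map sends boundaries to boundaries;
    exactness of [Y] renews it after each lift. *)
Lemma chain_lift (F0 : {linear X 0%N -> Y 0%N}) :
  (forall x, exists y, F0 (dX 0 x) = dY 0 y) ->
  exists F : forall n, {linear X n -> Y n},
    F 0%N = F0 /\ forall n x, dY n (F n.+1 x) = F n (dX n x).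
Proof.
move=> hF0.
pose T n := {linear X n -> Y n}.
pose Q n (F : T n) := forall x, exists y, F (dX n x) = dY n y.
pose S n (F : T n) (F' : T n.+1) := forall x, dY n (F' x) = F (dX n x).
have [n F QF|F [F0E _ SF]] := @dependent_choice T Q S F0 hF0; last first.
- by exists F; split.
have [x|G GE] := @projective_lift (X n.+1) (Y n.+1) (Y n) _ (F \o dX n) (dY n)
  (@projX n.+1).
  by have [y yE] := QF x; exists y; rewrite -yE.
by exists G => // x; apply: exactY; rewrite GE /= dX2 raddf0.
Qed.

(** The invariant is that what the homotopy built so far fails to account for in the next degree is
    a boundary, so it can be lifted through [dY]. *)
Lemma null_homotopy (F : forall n, {linear X n -> Y n}) :
  (forall x, exists y, F 0%N x = dY 0 y) ->
  (forall n x, dY n (F n.+1 x) = F n (dX n x)) ->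
  exists s : forall n, {linear X n -> Y n.+1},
    (forall x, F 0%N x = dY 0 (s 0%N x)) /\
    forall n x, F n.+1 x = dY n.+1 (s n.+1 x) + s n (dX n x).
Proof.
move=> F0 Fd.
pose T n := {linear X n -> Y n.+1}.
pose Q n (s : T n) := forall x, exists y, F n.+1 x - s (dX n x) = dY n.+1 y.
pose S n (s : T n) (s' : T n.+1) :=
  forall x, F n.+1 x = dY n.+1 (s' x) + s (dX n x).
have [x|s0 s0E] := @projective_lift _ _ _ _ (F 0%N) (dY 0) (@projX 0%N).
  by have [y yE] := F0 x; exists y; rewrite -yE.
have Q0 : Q 0%N s0.
  by move=> x; apply: exactY; rewrite raddfB /= Fd s0E subrr.
have [n s Qs|s [s0' _ Ss]] := @dependent_choice T Q S s0 Q0; last first.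
  by exists s; split=> // x; rewrite s0' s0E.
have [x|s' s'E] := @projective_lift (X n.+1) (Y n.+2) (Y n.+1) _
  (F n.+1 \- (s \o dX n)) (dY n.+1) (@projX n.+1).
  by have [y yE] := Qs x; exists y; rewrite -yE.
have sE x : F n.+1 x = dY n.+1 (s' x) + s (dX n x) by rewrite s'E /= subrK.
exists s' => // x; apply: exactY; rewrite raddfB /= Fd sE dX2 raddf0 addr0.
exact: subrr.
Qed.

End Complexes.
End Lifting.

(** * Homogeneous components *)

Section Gradings.
Variables (M : zmodType) (gr : nat -> set M).
Hypothesis grM : is_grading gr.

Lemma grading_ind (Q : M -> Prop) :
  Q 0 -> (forall x y, Q x -> Q y -> Q (x + y)) ->
  (forall j x, gr j x -> Q x) -> forall x, Q x.
Proof.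
move=> Q0 QD Qh x; have [n [c [hc ->]]] := grading_span grM x.
by elim/big_ind: _ => // j _; apply: Qh (hc j).
Qed.

Lemma grading_unique m n (c e : nat -> M) :
  (forall j, gr j (c j)) -> (forall j, gr j (e j)) ->
  \sum_(j < m) c j = \sum_(j < n) e j -> forall j,
  (if (j < m)%N then c j else 0) = if (j < n)%N then e j else 0.
Proof.
move=> hc he ce j; pose c' k := if (k < m)%N then c k else 0.
pose e' k := if (k < n)%N then e k else 0.
have h0 k : gr k 0 by exact: grading0 grM k.
have hce k : gr k (c' k - e' k).
  by apply: (gradingB grM); rewrite /c' /e'; case: ifP.
have [jmn|] := ltnP j (m + n); last first.
  move=> mnj; rewrite !ltnNge (leq_trans _ mnj) ?leq_addr //.
  by rewrite (leq_trans _ mnj) ?leq_addl.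
apply/eqP; rewrite -subr_eq0; apply/eqP.
apply: (grading_indep grM hce _ jmn); rewrite sumrB.
apply/eqP; rewrite subr_eq0; apply/eqP.
rewrite (big_ord_widen (m + n) c) ?leq_addr // in ce.
rewrite (big_ord_widen (m + n) e) ?leq_addl // in ce.
rewrite big_mkcond [RHS]big_mkcond in ce. exact: ce.
Qed.

(** Decompositions are chosen one element at a time; their uniqueness is what makes the chosen
    components additive. *)
Lemma grading_comp : exists c : nat -> M -> M,
  [/\ forall j, zmod_morphism (c j), forall j x, gr j (c j x),
      forall j x, gr j x -> c j x = x
    & forall i j x, gr i x -> i != j -> c j x = 0].
Proof.
have h0 k : gr k 0 by exact: grading0 grM k.
have /choice[n] := grading_span grM => /choice[c hc].
have gc x j : gr j (c x j) by have [] := hc x.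
have xE x : x = \sum_(j < n x) c x j by have [] := hc x.
(* The chosen family is arbitrary homogeneous beyond [n x], so it is cut off there. *)
pose f j x := if (j < n x)%N then c x j else 0.
have gf j x : gr j (f j x) by rewrite /f; case: ifP.
have fE x N : (n x <= N)%N -> x = \sum_(j < N) f j x.
  by move=> nN; rewrite {1}(xE x) (big_ord_widen N (c x)) // big_mkcond.
exists f; split=> // [j x y|j x xj|i j x xi ij].
- pose N := maxn (n x) (n y).
  have xyN : x - y = \sum_(j < N) (f j x - f j y).
    by rewrite sumrB -!fE // ?leq_maxl ?leq_maxr.
  have gB k : gr k (f k x - f k y) by apply: (gradingB grM).
  apply: etrans (grading_unique (gc (x - y)) gB (etrans (esym (xE _)) xyN) j) _.
  case: ltnP => // Nj.
  by rewrite /f !ltnNge !(leq_trans _ Nj) ?leq_maxl ?leq_maxr ?subrr.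
- have g1 k : gr k (if k == j then x else 0) by case: eqP => [->|].
  have xj1 : x = \sum_(k < j.+1) (if val k == j then x else 0).
    rewrite big_ord_recr /= eqxx big1 ?add0r // => k _.
    by rewrite ltn_eqF.
  apply: etrans (grading_unique (gc x) g1 (etrans (esym (xE _)) xj1) j) _.
  by rewrite ltnSn eqxx.
- have g1 k : gr k (if k == i then x else 0) by case: eqP => [->|].
  have xi1 : x = \sum_(k < i.+1) (if val k == i then x else 0).
    rewrite big_ord_recr /= eqxx big1 ?add0r // => k _.
    by rewrite ltn_eqF.
  apply: etrans (grading_unique (gc x) g1 (etrans (esym (xE _)) xi1) j) _.
  by rewrite eq_sym (negPf ij) if_same.
Qed.

End Gradings.

(** The component of degree [j] of [x] serves as preimage, since a map of degree 0 commutes with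
    taking components. *)
Lemma graded_preimage (M N : zmodType) (gM : nat -> set M) (gN : nat -> set N)
    (d : {additive M -> N}) j x :
  is_grading gM -> is_grading gN -> (forall k y, gM k y -> gN k (d y)) ->
  gN j (d x) -> exists2 y, gM j y & d y = d x.
Proof.
move=> hM hN hd dxj.
have [c [cB cgr cid c0]] := grading_comp hM.
have [e [eB egr eid e0]] := grading_comp hN.
pose cl := GRing.isZmodMorphism.Build M M (c j) (cB j).
pose el := GRing.isZmodMorphism.Build N N (e j) (eB j).
pose ca : {additive M -> M} := HB.pack (c j) cl.
pose ea : {additive N -> N} := HB.pack (e j) el.
have c00 : c j 0 = 0 by exact: (raddf0 ca).
have e00 : e j 0 = 0 by exact: (raddf0 ea).
have cD y z : c j (y + z) = c j y + c j z by exact: (raddfD ca).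
have eD y z : e j (y + z) = e j y + e j z by exact: (raddfD ea).
exists (c j x) => //; rewrite -[RHS](eid j) //.
elim/(grading_ind hM): x {dxj} => [|y z yE zE|k y yk].
- by rewrite c00 raddf0 e00.
- by rewrite cD !raddfD /= eD yE zE.
have [kj|kj] := eqVneq k j; first by rewrite -kj cid // eid //; apply: hd.
by rewrite (c0 k) // (e0 k) ?raddf0 //; apply: hd.
Qed.

Section FreeModules.
Variables (R : nzRingType) (I : finType).

Definition fmod : lmodType R := {ffun I -> R^o}.
Definition fbasis (i : I) : fmod := [ffun j => ((i == j)%:R : R^o)].

Lemma fbasisE i j : fbasis i j = (i == j)%:R.
Proof. by rewrite ffunE. Qed.

Lemma fmodZE (r : R) (x : fmod) i : (r *: x) i = r * x i.
Proof. by rewrite ffunE. Qed.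

Lemma fmod_sum (x : fmod) : x = \sum_i (x i : R) *: fbasis i.
Proof.
apply/ffunP => j; rewrite sum_ffunE (bigD1 j) //= fmodZE fbasisE eqxx.
rewrite [_ * _]mulr1 big1 ?addr0 // => i ij.
by rewrite fmodZE fbasisE (negPf ij); apply: mulr0.
Qed.

Definition fmod_ext (N : lmodType R) (v : I -> N) (x : fmod) : N :=
  \sum_i (x i : R) *: v i.

Lemma fmod_ext_linear (N : lmodType R) (v : I -> N) : linear (fmod_ext v).
Proof.
move=> r x y; rewrite scaler_sumr -big_split /=; apply: eq_bigr => i _.
by rewrite !ffunE scalerDl scalerA.
Qed.
HB.instance Definition _ (N : lmodType R) (v : I -> N) :=
  GRing.isLinear.Build R fmod N *:%R (fmod_ext v) (fmod_ext_linear v).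

Lemma fmod_ext_basis (N : lmodType R) (v : I -> N) i :
  fmod_ext v (fbasis i) = v i.
Proof.
rewrite /fmod_ext (bigD1 i) //= fbasisE eqxx scale1r big1 ?addr0 // => j ji.
by rewrite fbasisE eq_sym (negPf ji) scale0r.
Qed.

Lemma fmod_linear_eq (Z : zmodType) (s : R -> Z -> Z)
    (f g : {linear fmod -> Z | s}) :
  (forall i, f (fbasis i) = g (fbasis i)) -> forall x, f x = g x.
Proof.
move=> fg x; rewrite (fmod_sum x) !raddf_sum; apply: eq_bigr => i _ /=.
by rewrite !linearZ_LR fg.
Qed.

Lemma fmod_projective : projective fmod.
Proof.
move=> M N p f /(_ (f (fbasis _)))/cid-/all_sig[v vE].
exists (fmod_ext v) => x; rewrite [in RHS](fmod_sum x) !raddf_sum.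
by apply: eq_bigr => i _ /=; rewrite !linearZ_LR /= vE.
Qed.

End FreeModules.

(** * Minimal resolutions *)

(** Modules are left modules, so a matrix acts on row vectors from the right. *)
Definition mxmap (R : nzRingType) (I J : finType) (D : I -> J -> R) :
    {linear fmod R I -> fmod R J} :=
  fmod_ext (fun i => [ffun j => (D i j : R^o)] : fmod R J).

Lemma mxmapE (R : nzRingType) (I J : finType) (D : I -> J -> R)
    (x : fmod R I) j :
  mxmap D x j = \sum_i (x i : R) * D i j.
Proof.
rewrite /mxmap /= /fmod_ext sum_ffunE; apply: eq_bigr => i _.
by rewrite fmodZE ffunE.
Qed.

Section MinimalResolutions.
Variables (K : fieldType) (R : nzRingType) (gR : nat -> set R).
Variable aug : {rmorphism R -> K}.
Hypothesis grR : is_grading gR.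
Hypothesis aug_gr : forall j r, gR j r -> (0 < j)%N -> aug r = 0.

(** Projecting to degree [j] is not [R]-linear, but it becomes so after composing with a map to [K],
    on which positive degrees of [R] act by zero. *)
Lemma homk_component (M : lmodType R) (gr : nat -> set M) (f : homk aug M) j :
  is_graded_module gR gr ->
  exists f' : homk aug M, (forall x, gr j x -> f' x = f x) /\
    forall k x, gr k x -> k != j -> f' x = 0.
Proof.
move=> [grM grZ]; have [c [cB cgr cid c0]] := grading_comp grM.
pose cl := GRing.isZmodMorphism.Build M M (c j) (cB j).
pose ca : {additive M -> M} := HB.pack (c j) cl.
have c00 : c j 0 = 0 by exact: (raddf0 ca).
have cD y z : c j (y + z) = c j y + c j z by exact: (raddfD ca).
pose g x := f (c j x).
have gZ r x : g (r *: x) = aug r * g x.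
  rewrite /g; elim/(grading_ind grR): r => [|r s rE sE|i r ri].
  - by rewrite scale0r c00 !raddf0 mul0r.
  - by rewrite scalerDl cD !raddfD /= rE sE mulrDl.
  elim/(grading_ind grM): x => [|x y xE yE|k x xk].
  - by rewrite scaler0 c00 raddf0 mulr0.
  - by rewrite scalerDr !cD !raddfD /= xE yE mulrDr.
  have rx := grZ _ _ _ _ ri xk.
  case: i => [|i] in ri rx *.
    have [kj|kj] := eqVneq k j; first by rewrite -kj !cid ?linearZ_LR.
    by rewrite (c0 (0 + k)%N) // (c0 k) // raddf0 mulr0.
  rewrite (aug_gr ri) // mul0r.
  have [kj|kj] := eqVneq (i.+1 + k)%N j; last by rewrite (c0 _ _ _ rx) ?raddf0.
  by rewrite cid -?kj // linearZ_LR /= (aug_gr ri) // mul0r.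
have g_linear : linear_for (aug \; *%R) g.
  by move=> r x y; rewrite /= -gZ /g cD raddfD.
pose gL := GRing.isLinear.Build R M K (aug \; *%R) g g_linear.
pose gl : homk aug M := HB.pack g gL.
exists gl; split=> [x xj|k x xk kj]; first by rewrite /= /g cid.
by rewrite /= /g (c0 k) // raddf0.
Qed.

Definition homk0_fun (M : lmodType R) (_ : M) : K := 0.

Lemma homk0_linear M : linear_for (aug \; *%R) (@homk0_fun M).
Proof. by move=> r x y; rewrite /homk0_fun /= mulr0 addr0. Qed.
HB.instance Definition _ M := GRing.isLinear.Build R M K (aug \; *%R)
  (@homk0_fun M) (@homk0_linear M).

Definition homk0 (M : lmodType R) : homk aug M := @homk0_fun M.

Section FreeHomk.
Variable I : finType.

Lemma homk_fmod (f : homk aug (fmod R I)) (x : fmod R I) :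
  f x = \sum_i aug (x i) * f (fbasis R i).
Proof.
rewrite [in LHS](fmod_sum x) raddf_sum; apply: eq_bigr => i _ /=.
by rewrite linearZ_LR.
Qed.

Lemma homk_fmod0 (f : homk aug (fmod R I)) (x : fmod R I) :
  (forall i, aug (x i) = 0) -> f x = 0.
Proof. by move=> x0; rewrite homk_fmod big1 // => i _; rewrite x0 mul0r. Qed.

Definition fcoord (i : I) (x : fmod R I) : K := aug (x i).

Lemma fcoord_linear i : linear_for (aug \; *%R) (fcoord i).
Proof. by move=> r x y; rewrite /fcoord !ffunE rmorphD rmorphM. Qed.
HB.instance Definition _ i := GRing.isLinear.Build R (fmod R I) K
  (aug \; *%R) (fcoord i) (fcoord_linear i).

End FreeHomk.

(** Minimality is [mr_mx_aug]: every matrix entry lies in the augmentation ideal. By [mr_mx_gr] a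
    nonzero entry has the difference of the two generator degrees as its degree. *)
Record minimal_resolution := MinimalResolution {
  mr_gen : nat -> finType;
  mr_deg : forall n, mr_gen n -> nat;
  mr_mx : forall n, mr_gen n.+1 -> mr_gen n -> R;
  mr_eps : homk aug (fmod R (mr_gen 0));
  mr_mx_gr : forall n i j, mr_mx i j = 0 \/
    exists2 k, @mr_deg n.+1 i = (k + @mr_deg n j)%N & gR k (mr_mx i j);
  mr_deg0 : forall i : mr_gen 0, mr_deg i = 0%N;
  mr_mx_aug : forall n i j, aug (@mr_mx n i j) = 0;
  mr_eps_surj : forall a, exists x, mr_eps x = a;
  mr_exact0 : forall x, mr_eps x = 0 <-> exists y, x = mxmap (@mr_mx 0) y;
  mr_exact : forall n x,
    mxmap (@mr_mx n) x = 0 <-> exists y, x = mxmap (@mr_mx n.+1) y }.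

(** * Comparison of a minimal resolution with an arbitrary one *)

Section Comparison.
Variable Q : minimal_resolution.
Variable P : resolution gR aug.

Let M n := fmod R (mr_gen Q n).
Let d n : {linear M n.+1 -> M n} := mxmap (@mr_mx Q n).
Let e n (i : mr_gen Q n) : M n := fbasis R i.

Lemma mr_minimal n (f : homk aug (M n)) x : f (d n x) = 0.
Proof.
apply: homk_fmod0 => j; rewrite mxmapE raddf_sum big1 // => i _ /=.
by rewrite rmorphM mr_mx_aug mulr0.
Qed.

Lemma mr_minimal_comp n (N : lmodType R) (w : homk aug N)
    (t : {linear M n -> N}) x :
  w (t (d n x)) = 0.
Proof. exact: (mr_minimal (w \o t)). Qed.

Lemma mr_d2 n x : d n (d n.+1 x) = 0.
Proof. by apply/mr_exact; exists x. Qed.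

Lemma res_d2 n x : res_d P n (res_d P n.+1 x) = 0.
Proof. by apply/res_exact; exists x. Qed.

Lemma res_eps_gr0 x : exists2 y, res_gr 0 y & res_eps P y = res_eps P x.
Proof.
have [grP _] := res_graded P 0%N.
elim/(grading_ind grP): x => [|x x' [y y0 yE] [y' y'0 y'E]|k x xk].
- by exists 0 => //; apply: grading0 grP _.
- exists (y + y'); first exact: gradingD.
  by rewrite !raddfD /= yE y'E.
case: k => [|k] in xk *; first by exists x.
exists 0; first exact: grading0 grP _.
by rewrite raddf0 (res_eps_gr xk).
Qed.

(** The lift is chosen on bases rather than by [chain_lift], so that [graded_preimage] can keep the
    images of basis elements homogeneous. *)
Lemma mr_lift : exists phi : forall n, {linear M n -> res_mod P n},
  [/\ forall x, res_eps P (phi 0%N x) = mr_eps Q x,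
      forall n x, res_d P n (phi n.+1 x) = phi n (d n x)
    & forall n i, res_gr (mr_deg i) (phi n (e i))].
Proof.
pose T n := {linear M n -> res_mod P n}.
pose S n (F : T n) (F' : T n.+1) := forall x, res_d P n (F' x) = F (d n x).
pose C n (F : T n) := (forall i, res_gr (mr_deg i) (F (e i))) /\
  forall x, exists y, F (d n x) = res_d P n y.
have grP n := (res_graded P n).1; have grZ n := (res_graded P n).2.
have /choice[v vE] i : exists y, res_gr 0 y /\ res_eps P y = mr_eps Q (e i).
  have [x xE] := res_eps_surj P (mr_eps Q (e i)).
  by have [y y0 yE] := res_eps_gr0 x; exists y; rewrite -xE.
pose F0 : T 0%N := fmod_ext v.
have F0E x : res_eps P (F0 x) = mr_eps Q x.
  apply: (@fmod_linear_eq _ _ _ _ (res_eps P \o F0) (mr_eps Q)) => i.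
  by rewrite /F0 /= fmod_ext_basis (vE i).2.
have C0 : C 0%N F0.
  split=> [i|x]; first by rewrite /F0 /= fmod_ext_basis mr_deg0; case: (vE i).
  by apply/res_exact0; rewrite F0E mr_minimal.
have [n F [Fgr Fd]|phi [phi0 Cphi Sphi]] := @dependent_choice T C S F0 C0.
  have /choice[w wE] i : exists y, res_gr (mr_deg i) y /\
      res_d P n y = F (d n (e i)).
    have [y yE] := Fd (e i).
    have dyi : res_gr (mr_deg i) (res_d P n y).
      rewrite -yE (fmod_sum (d n (e i))) raddf_sum /=.
      elim/big_ind: _ => [|x z|j _]; [exact: grading0|exact: gradingD|].
      rewrite linearZ_LR /d /= fmod_ext_basis ffunE.
      have [->|[k -> gk]] := mr_mx_gr i j; last exact: grZ.
      by rewrite scale0r; apply: grading0.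
    have [z zi zE] := graded_preimage (grP n.+1) (grP n)
      (@res_d_gr _ _ _ _ P n) dyi.
    by exists z; rewrite zE yE.
  pose G : T n.+1 := fmod_ext w.
  have GE x : res_d P n (G x) = F (d n x).
    apply: (@fmod_linear_eq _ _ _ _ (res_d P n \o G) (F \o d n)) => i.
    by rewrite /G [LHS]/= fmod_ext_basis (wE i).2.
  exists G => //; split=> [i|x].
    by rewrite /G /= fmod_ext_basis; case: (wE i).
  by apply/res_exact; rewrite GE mr_d2 raddf0.
exists phi; split=> // [x|n i]; first by rewrite phi0.
by have [] := Cphi n.
Qed.

(** A homotopy equivalence between the two resolutions. Homogeneity is asserted of [phi] only. *)
Lemma mr_compare : exists (phi : forall n, {linear M n -> res_mod P n})
    (psi : forall n, {linear res_mod P n -> M n}),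
  [/\ forall n x, res_d P n (phi n.+1 x) = phi n (d n x),
      forall n x, d n (psi n.+1 x) = psi n (res_d P n x),
      forall n i, res_gr (mr_deg i) (phi n (e i)),
      exists s : forall n, {linear res_mod P n -> res_mod P n.+1},
        (forall x, x - phi 0%N (psi 0%N x) = res_d P 0 (s 0%N x)) /\
        forall n x, x - phi n.+1 (psi n.+1 x) =
          res_d P n.+1 (s n.+1 x) + s n (res_d P n x)
    & exists t : forall n, {linear M n -> M n.+1},
        forall n x, x - psi n.+1 (phi n.+1 x) =
          d n.+1 (t n.+1 x) + t n (d n x)].
Proof.
have [phi [phi0 phid phigr]] := mr_lift.
have projM n : projective (M n) by exact: fmod_projective.
have exM n y : d n y = 0 -> exists z, y = d n.+1 z by move=> /mr_exact.
have exP n y : res_d P n y = 0 -> exists z, y = res_d P n.+1 z.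
  by move=> /res_exact.
have [x|psi0 psi0E] := @projective_lift _ (res_mod P 0) (M 0%N) _ _
  (res_eps P) (mr_eps Q) (@res_proj _ _ _ _ P 0).
  by have [y yE] := mr_eps_surj Q (res_eps P x); exists y.
have [x|psi [psiE psid]] := @chain_lift _ _ _ (res_d P) d
    (@res_proj _ _ _ _ P) res_d2 exM psi0.
  by apply/mr_exact0; rewrite psi0E; apply/res_exact0; exists x.
have {}psi0E x : mr_eps Q (psi 0%N x) = res_eps P x by rewrite psiE.
exists phi, psi; split=> //.
  apply: (@null_homotopy _ _ _ (res_d P) (res_d P) (@res_proj _ _ _ _ P)
    res_d2 exP (fun n => idfun \- (phi n \o psi n))) => [x|n x] /=.
    by apply/res_exact0; rewrite raddfB /= phi0 psi0E subrr.
  by rewrite raddfB /= phid psid.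
have [x|n x|t [_ tE]] := @null_homotopy _ _ _ d d projM mr_d2 exM
    (fun n => idfun \- (psi n \o phi n)).
- by apply/mr_exact0; rewrite raddfB /= psi0E phi0 subrr.
- by rewrite [LHS]raddfB [LHS]/= psid phid.
by exists t.
Qed.

(** A cocycle [f] of degree [j] vanishes on the image of [phi] for degree reasons. Hence [f] agrees
    with its value on [x - phi n (psi n x)], which the homotopy turns into a coboundary. *)
Lemma ext_eq0_deg n j : (forall i : mr_gen Q n, mr_deg i <> j) -> ext_eq0 P n j.
Proof.
move=> degn f fj fd; have [phi [psi [_ _ phigr [s [s0 sS]] _]]] := mr_compare.
have fphi x : f (phi n x) = 0.
  rewrite (homk_fmod (f \o phi n : homk aug (M n)) x : f (phi n x) = _).
  by rewrite big1 // => i _; rewrite /= (fj _ _ (phigr n i)) ?mulr0.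
have fE x : f x = f (x - phi n (psi n x)) by rewrite raddfB /= fphi subr0.
case: n => [|n] in f fj fd degn fphi fE *.
  by move=> x; rewrite fE s0 fd.
(* The homotopy may mix internal degrees, so only the degree [j] part of [f \o s n] is kept. *)
have [h [hj h0]] := homk_component (f \o s n) j (res_graded P n).
exists h; split=> [k x xk /eqP|x]; first exact: h0 xk.
have [grP _] := res_graded P n.+1.
elim/(grading_ind grP): x => [|x y xE yE|k x xk].
- by rewrite !raddf0.
- by rewrite !raddfD /= xE yE.
have dxk := res_d_gr xk; have [kj|kj] := eqVneq k j; last first.
  by rewrite (h0 _ _ dxk) // (fj _ _ xk) //; apply/eqP.
by rewrite hj -?kj //= fE sS raddfD /= fd add0r.
Qed.

(** A cocycle in degree 0 factors through [res_eps], so it is determined by one value. *)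
Lemma homk_augmentation (g : homk aug (res_mod P 0)) x1 x :
  (forall y, g (res_d P 0 y) = 0) -> res_eps P x1 = 1 ->
  (exists z, aug z = res_eps P x) -> g x = g x1 * res_eps P x.
Proof.
move=> gd x1E [z zE]; have [|y yE] := (res_exact0 (r := P) (x - z *: x1)).1.
  by rewrite raddfB /= linearZ_LR /= zE x1E mulr1 subrr.
have := gd y; rewrite -yE raddfB /= linearZ_LR /= zE mulrC => /eqP.
by rewrite subr_eq0 => /eqP.
Qed.

Lemma single_cochain m (w : homk aug (res_mod P m)) :
  exists f : cochain P, f m = w /\ forall i, i != m -> forall x, f i x = 0.
Proof.
exists (fun i => if @eqP _ m i is ReflectT E
  then ecast k (homk aug (res_mod P k)) E w else homk0 (res_mod P i)).
split=> [|i im x]; case: eqP => // E; first by rewrite eq_axiomK.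
by rewrite E eqxx in im.
Qed.

(* Yoneda products are computed by chain endomorphisms of [Q], so that the dual
   of such a basis element is not a combination of products of classes of
   lower cohomological degree. *)
Definition indecomposable m (u : mr_gen Q m) : Prop :=
  forall H : forall m n, {linear M m -> M n},
    (forall m n x, d n (H m.+1 n.+1 x) = H m n (d m x)) ->
    forall n, (0 < n < m)%N -> forall i, aug (H m n (e u) i) = 0.

(** Evaluation at [phi m.+1 (e u)] depends only on the cohomology class, and its kernel on cocycles
    is stable under every rule generating the subalgebra. Products are the essential case. *)
Lemma ext_subalgebra_indecomposable (S : set (cochain P)) m
    (u : mr_gen Q m.+1) (phi : forall n, {linear M n -> res_mod P n})
    (psi : forall n, {linear res_mod P n -> M n})
    (s : forall n, {linear res_mod P n -> res_mod P n.+1}) :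
  (forall a : K, exists z : R, aug z = a /\ forall r, z * r = r * z) ->
  (forall n x, res_d P n (phi n.+1 x) = phi n (d n x)) ->
  (forall n x, d n (psi n.+1 x) = psi n (res_d P n x)) ->
  (forall n x, x - phi n.+1 (psi n.+1 x) =
          res_d P n.+1 (s n.+1 x) + s n (res_d P n x)) ->
  indecomposable u ->
  (forall f, S f -> (forall i x, f i (res_d P i x) = 0) /\
    f m.+1 (phi m.+1 (e u)) = 0) ->
  forall f, ext_subalgebra S f -> (forall i x, f i (res_d P i x) = 0) /\
    f m.+1 (phi m.+1 (e u)) = 0.
Proof.
move=> central phid psid sE indu S0 f; elim=> {f}.
- exact: S0.
- move=> f [f0 fS]; split=> [[|i] x|]; rewrite ?f0 ?fS //.
  by apply/res_exact0; exists x.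
- move=> a f g h _ [fd f0] _ [gd g0] hE; split=> [i x|].
    by rewrite hE fd gd mulr0 addr0.
  by rewrite hE f0 g0 mulr0 addr0.
- move=> f g h _ [fd f0] _ [gd g0] [_ hd] [G [Geps Gd hG]]; split=> //.
  pose U := phi m.+1 (e u).
  have dU (N : lmodType R) (w : homk aug N) (t : {linear res_mod P m -> N}) :
      w (t (res_d P m U)) = 0.
    by rewrite /U phid; exact: (mr_minimal_comp w (t \o phi m)).
  (* The sum is split into [n = 0], the intermediate [n], and [n = m.+1]. *)
  rewrite hG big_ord_recl big_ord_recr /=.
  (* For [n = 0] the augmentation of the argument is the value of [g] at [U], which is 0; so the
     argument is a boundary. *)
  have -> : f 0%N (G m.+1 0%N U) = 0.
    have [|y ->] := (res_exact0 (r := P) (G m.+1 0%N U)).1; last exact: fd.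
    by rewrite Geps.
  rewrite add0r big1 => [|[n nm] _] /=; rewrite /bump /= ?add0n ?add1n.
    rewrite add0r.
    (* For [n = m.+1] only the diagonal part of [G] enters. It is homotopic to multiplication by a
       central [z] lifting the scalar [g 0%N x1], so the term is that scalar times the value of [f]
       at [U], which is 0. *)
    have [x1 x1E] := res_eps_surj P 1.
    have [z [zE zC]] := central (g 0%N x1).
    pose F n (x : res_mod P n) := G n n x - z *: x.
    have F_lin n : linear (F n).
      move=> r x y; rewrite /F linearP scalerDr !scalerBr !scalerA zC.
      by rewrite opprD addrACA.
    pose Fl n : {linear res_mod P n -> res_mod P n} :=
      HB.pack (F n) (GRing.isLinear.Build R _ _ *:%R (F n) (F_lin n)).
    have [x|n x|t [_ tE]] := @null_homotopy _ _ _ (res_d P) (res_d P)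
      (@res_proj _ _ _ _ P) res_d2 (fun n y => (res_exact (r := P) y).1) Fl.
    + apply/res_exact0; rewrite /= /F raddfB /= linearZ_LR /= Geps zE.
      rewrite (@homk_augmentation _ x1) ?subrr //.
      by have [z' [z'E _]] := central (res_eps P x); exists z'.
    + by rewrite /= /F raddfB /= linearZ_LR /= Gd.
    have := congr1 (f m.+1) (tE m U).
    rewrite [in RHS]raddfD /= fd (dU _ (f m.+1) (t m)) addr0 /F raddfB /=.
    by rewrite linearZ_LR /= f0 mulr0 subr0.
  (* For intermediate [n], minimality allows [y] to be replaced by [phi n.+1 (psi n.+1 y)]. Then
     [H], the transport of [G] to [Q], is a chain endomorphism to which indecomposability
     applies. *)
  set y := G m.+1 n.+1 U.
  have fy : f n.+1 (y - phi n.+1 (psi n.+1 y)) = 0.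
    rewrite sE raddfD /= fd add0r /y Gd.
    exact: (dU _ (f n.+1) (s n \o G m n)).
  move: fy; rewrite raddfB => /eqP; rewrite subr_eq0 => /eqP ->.
  pose H i j : {linear M i -> M j} := psi j \o (G i j \o phi i).
  apply: (@homk_fmod0 _ (f n.+1 \o phi n.+1)) => i.
  apply: (indu H); last by rewrite ltnS.
  by move=> i' j' x; rewrite /H [LHS]/= psid Gd phid.
- move=> f g _ [fd f0] [_ gd] [_ [h [_ hE]]]; split=> //.
  apply/eqP; rewrite -[X in _ == X]f0 hE phid.
  by rewrite mr_minimal_comp addr0.
Qed.

(** Finitely many generators live in bounded cohomological degree. Beyond the bound they all vanish
    at an indecomposable [u], whereas the class dual to [u] does not. *)
Lemma yoneda_not_fin_gen :
  (forall a : K, exists z : R, aug z = a /\ forall r, z * r = r * z) ->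
  (forall N, exists m, exists2 u : mr_gen Q m.+1,
    (N <= m)%N & indecomposable u) ->
  ~ yoneda_fin_gen P.
Proof.
move=> central indec [k [gen [gen_cocycle gen_all]]].
have [phi [psi [phid psid phigr [s [_ sE]] [t tE]]]] := mr_compare.
have /choice[B hB] i := (gen_cocycle i).1.
have [m [u Nm indu]] := indec (\max_i B i)%N.
(* The dual of [u], carried over to [P] and cut down to one internal degree, because a finite
   cochain is bounded in internal degree too. *)
have [w [wu w0]] := homk_component (@fcoord _ u \o psi m.+1) (mr_deg u)
  (res_graded P m.+1).
have [f [fm f0]] := single_cochain w.
have grP n := (res_graded P n).1.
have wd x : w (res_d P m.+1 x) = 0.
  elim/(grading_ind (grP m.+2)): x => [|x y xE yE|j x xj].
  - by rewrite !raddf0.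
  - by rewrite !raddfD /= xE yE addr0.
  have dxj := res_d_gr xj; have [ju|ju] := eqVneq j (mr_deg u).
    by rewrite wu -?ju //= -psid; apply: (mr_minimal (@fcoord _ u)).
  by rewrite (w0 _ _ dxj).
have f_cocycle : ext_cocycle f.
  split=> [|i x].
    exists (maxn m.+2 (mr_deg u).+1) => i j x xj.
    rewrite !geq_max => ij; have [im|im] := eqVneq i m.+1; last exact: f0.
    move: x xj ij; rewrite im fm ltnn /= => x xj [//|/andP[_ uj]].
    by apply: w0 xj _; rewrite gtn_eqF.
  have [im|im] := eqVneq i m.+1; last exact: f0.
  by move: x; rewrite im fm => x; rewrite wd.
have [] := @ext_subalgebra_indecomposable (range gen) m u phi psi s central
  phid psid sE indu _ f (gen_all f f_cocycle).
  move=> _ [i _ <-]; split; first by case: (gen_cocycle i).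
  apply: (hB i _ _ _ (phigr _ _)); left; rewrite ltnW // ltnS.
  exact: leq_trans (leq_bigmax i) Nm.
move=> _; rewrite fm wu //=.
(* The bracket is a homotopy term, which minimality kills; the coordinate of [e u] at [u]
   remains. *)
have -> : psi m.+1 (phi m.+1 (e u)) = e u - (e u - psi m.+1 (phi m.+1 (e u))).
  by rewrite opprB addrC subrK.
rewrite tE raddfB raddfD /= (mr_minimal (@fcoord _ u)).
rewrite (mr_minimal_comp (@fcoord _ u) (t m)) addr0 subr0 /fcoord fbasisE eqxx.
by rewrite rmorph1 => /eqP; rewrite oner_eq0.
Qed.

End Comparison.
End MinimalResolutions.

(** * The resolution over C *)

Section Syzygies.
Variables (K : fieldType) (R : nzRingType) (gR : nat -> set R).
Variable aug : {rmorphism R -> K}.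
Variable kappa : {rmorphism K -> R}.
Variables (X : finType) (letter : nat -> X) (x : X -> R).
Local Notation "''x_' k" := (x (letter k%N))
  (at level 0, k at level 2, format "''x_' k").
Local Notation a := 'x_0.
Local Notation b := 'x_1.
Local Notation c := 'x_2.
Local Notation d := 'x_3.
Local Notation e := 'x_4.
Local Notation f := 'x_5.
Local Notation l := 'x_6.
Local Notation m := 'x_7.
Local Notation z := 'x_8.

Definition delta_letter (k : nat) (r : R) v := if v == letter k then r else 0.

(* The Jacobian of the relations cl, ae, z^4, bc - ef, da - lm, in this order,
   so that the first three are those on which the resolution goes on. *)
Definition jacobian (i : nat) (v : X) : R :=
  match i with
  | 0 => delta_letter 6 c v
  | 1 => delta_letter 4 a v
  | 2 => delta_letter 8 (z * z * z) v
  | 3 => delta_letter 2 b v - delta_letter 5 e v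
  | _ => delta_letter 0 d v - delta_letter 7 l v
  end.

Hypothesis letter_eq : forall i j, (i < 9)%N -> (j < 9)%N ->
  (letter i == letter j) = (i == j).
Hypothesis grR : is_grading gR.
Hypothesis gRM : forall i j r s, gR i r -> gR j s -> gR (i + j)%N (r * s).
Hypothesis aug_gr : forall j r, gR j r -> (0 < j)%N -> aug r = 0.
Hypothesis gx : forall v, gR 1 (x v).
Hypothesis kappaK : cancel kappa aug.
Hypothesis kappaC : forall t r, kappa t * r = r * kappa t.
Hypothesis syzygy : forall y, \sum_v y v * x v = 0 ->
  exists t : 'I_5 -> R, forall v, y v = \sum_i t i * jacobian i v.
Hypothesis jacobian_syzygy : forall i : 'I_5, \sum_v jacobian i v * x v = 0.
Hypothesis span : forall r, aug r = 0 -> exists y, r = \sum_v y v * x v.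

Lemma augx v : aug (x v) = 0.
Proof. exact: aug_gr (gx v) _. Qed.

Lemma sum_delta_letter k r : \sum_v delta_letter k r v * x v = r * 'x_k.
Proof.
rewrite (bigD1 (letter k)) //= /delta_letter eqxx big1 ?addr0 // => v.
by move=> /negPf->; rewrite mul0r.
Qed.

Lemma relations : [/\ c * l = 0, a * e = 0, z * z * z * z = 0,
  b * c = e * f & d * a = l * m].
Proof.
have J i (i5 : (i < 5)%N) := jacobian_syzygy (Ordinal i5).
split.
- by rewrite -(J 0%N isT) -sum_delta_letter.
- by rewrite -(J 1%N isT) -sum_delta_letter.
- by rewrite -(J 2 isT) -sum_delta_letter.
- apply/eqP; rewrite -subr_eq0 -(J 3 isT) -!sum_delta_letter -sumrB.
  by apply/eqP; apply: eq_bigr => v _; rewrite -mulrBl.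
- apply/eqP; rewrite -subr_eq0 -(J 4 isT) -!sum_delta_letter -sumrB.
  by apply/eqP; apply: eq_bigr => v _; rewrite -mulrBl.
Qed.

Lemma sum_jacobian (t : 'I_5 -> R) v : \sum_i t i * jacobian i v =
  t (inord 0) * jacobian 0 v + (t (inord 1) * jacobian 1 v +
    (t (inord 2) * jacobian 2 v + (t (inord 3) * jacobian 3 v +
      t (inord 4) * jacobian 4 v))).
Proof.
do 5!rewrite big_ord_recl; rewrite big_ord0 addr0 /= /bump /=.
by do !congr (_ + _); congr (t _ * _); apply: val_inj; rewrite /= inordK.
Qed.

(** * Left annihilators of letters *)

Lemma syzygyE y : \sum_v y v * x v = 0 ->
  exists t0 t1 t2 t3 t4,
  [/\ y (letter 0) = t4 * d, y (letter 1) = 0, y (letter 2) = t3 * b,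
      y (letter 3) = 0 & y (letter 4) = t1 * a] /\
  [/\ y (letter 5) = - (t3 * e), y (letter 6) = t0 * c,
      y (letter 7) = - (t4 * l) & y (letter 8) = t2 * (z * z * z)].
Proof.
move=> /syzygy[t tE].
exists (t (inord 0)), (t (inord 1)), (t (inord 2)), (t (inord 3)).
exists (t (inord 4)).
by split; split; rewrite tE sum_jacobian /jacobian /delta_letter !letter_eq //=
  !(mulr0, add0r, addr0, subr0, sub0r, oppr0, mulrN).
Qed.

(** An element annihilating a letter is a syzygy with a single entry; the zero entries constrain the
    multipliers of the relations. *)
Lemma ann_letter k r : (k < 9)%N -> r * 'x_k = 0 ->
  let y j := if j == k then r else 0 in
  exists t0 t1 t2 t3 t4,
  [/\ y 0%N = t4 * d, y 1%N = 0, y 2 = t3 * b, y 3 = 0 & y 4 = t1 * a] /\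
  [/\ y 5 = - (t3 * e), y 6 = t0 * c, y 7 = - (t4 * l)
    & y 8 = t2 * (z * z * z)].
Proof.
move=> k9; rewrite -sum_delta_letter => /syzygyE.
by rewrite /delta_letter !letter_eq.
Qed.

(** Only [da - lm] has a term ending in [a], so [r = t4 * d]; its other term forces [t4 * l = 0],
    and then [cl] gives [t4 = s0 * c]. *)
Lemma ann_a r : r * a = 0 -> exists t, r = t * (c * d).
Proof.
move=> /(@ann_letter 0)[//|t0 [t1 [t2 [t3 [t4]]]]] /=.
move=> [[-> _ _ _ _] [_ _ /esym/eqP + _]].
rewrite oppr_eq0 => /eqP /(@ann_letter 6)[//|s0 [s1 [s2 [s3 [s4]]]]] /=.
move=> [_ [_ -> _ _]].
by exists s0; rewrite mulrA.
Qed.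

(** No relation has a term ending in [b], so that column of the Jacobian is zero; the same holds for
    [d]. *)
Lemma ann_b r : r * b = 0 -> r = 0.
Proof. by move=> /(@ann_letter 1)[//|t0 [t1 [t2 [t3 [t4]]]]] /= [[]]. Qed.

Lemma ann_d r : r * d = 0 -> r = 0.
Proof. by move=> /(@ann_letter 3)[//|t0 [t1 [t2 [t3 [t4]]]]] /= [[]]. Qed.

Lemma ann_c r : r * c = 0 -> exists t, r = t * (a * b).
Proof.
move=> /(@ann_letter 2)[//|t0 [t1 [t2 [t3 [t4]]]]] /=.
move=> [[_ _ -> _ _] [/esym/eqP + _ _ _]].
rewrite oppr_eq0 => /eqP /(@ann_letter 4)[//|s0 [s1 [s2 [s3 [s4]]]]] /=.
move=> [[_ _ _ _ ->] _].
by exists s1; rewrite mulrA.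
Qed.

Lemma ann_z r : r * z = 0 -> exists t, r = t * (z * z * z).
Proof.
move=> /(@ann_letter 8)[//|t0 [t1 [t2 [t3 [t4]]]]] /= [_ [_ _ _ ->]].
by exists t2.
Qed.

(** One [z] is cancelled at a time; each cancellation leaves a multiple of [z * z * z], which is
    moved to the other side. *)
Lemma ann_zzz r : r * (z * z * z) = 0 -> exists t, r = t * z.
Proof.
rewrite !mulrA => /ann_z[t /eqP]; rewrite !mulrA -subr_eq0 -!mulrBl => /eqP.
move=> /ann_z[s /eqP]; rewrite !mulrA -subr_eq0 -mulrBl => /eqP.
move=> /ann_z[u uE]; exists (t + s * z + u * z * z).
rewrite !mulrDl; move: uE; rewrite !mulrA => <-.
set A := t * z; set B := s * z * z.
by rewrite -[r - A - B]addrA -opprD [RHS]addrC subrK.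
Qed.

(* From homological degree 2 on, the differential is diagonal: it multiplies
   the [k]-th basis element of degree [n + 2] by [alpha n k]. *)
Definition alpha (n k : nat) : R :=
  match k with
  | 0 => if odd n then c * d else a * b
  | 1 => if odd n then a * b else c * d
  | _ => if odd n then z * z * z else z
  end.

(** Here [abcd = aefd = 0] and [cdab = clmb = 0]. Conversely the final [b] or [d] cancels, which
    leaves the annihilator of [a] or [c]. *)
Lemma alpha_ann n k r : r * alpha n k = 0 <-> exists t, r = t * alpha n.+1 k.
Proof.
have [cl ae z4 bc da] := relations.
have abcd : a * b * (c * d) = 0.
  by rewrite -!mulrA [b * (c * d)]mulrA bc !mulrA ae !mul0r.
have cdab : c * d * (a * b) = 0.
  by rewrite -!mulrA [d * (a * b)]mulrA da !mulrA cl !mul0r.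
have annab s : s * (a * b) = 0 -> exists t, s = t * (c * d).
  by rewrite mulrA => /ann_b/ann_a.
have anncd s : s * (c * d) = 0 -> exists t, s = t * (a * b).
  by rewrite mulrA => /ann_d/ann_c.
have zz : z * (z * z * z) = 0 by rewrite !mulrA.
split.
  by case: k => [|[|k]] /=; case: odd => //=;
    [exact: anncd|exact: annab|exact: annab|exact: anncd|exact: ann_zzz|
     exact: ann_z].
by case=> t ->; rewrite -mulrA; case: k => [|[|k]] /=; case: odd => //=;
  rewrite ?abcd ?cdab ?zz ?z4 mulr0.
Qed.

(** The number of generators in homological degree [n.+2]. Degree 2 has one for each relation; those
    of [bc - ef] and [da - lm], with indices 3 and 4, have no successors. *)
Definition res_size (n : nat) : nat := if n is 0 then 5 else 3.

Definition res_gen (n : nat) : finType :=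
  match n with
  | 0 => unit
  | 1 => X
  | n.+2 => 'I_(res_size n)
  end.

Definition resolution_deg (n : nat) : res_gen n -> nat :=
  match n with
  | 0 => fun _ => 0%N
  | 1 => fun _ => 1%N
  | n.+2 => fun i : 'I_(res_size n) =>
      if (i < 2)%N then n.*2.+2
      else if i == 2 :> nat then Defs.delta 4 n.+2 else 2
  end.

Definition resolution_mx (n : nat) : res_gen n.+1 -> res_gen n -> R :=
  match n with
  | 0 => fun v _ => x v
  | 1 => fun i v => jacobian i v
  | n.+2 => fun (i : 'I_3) (j : 'I_(res_size n)) =>
      if i == j :> nat then alpha n i else 0
  end.

Lemma jacobian_gr (i : 'I_5) v :
  gR (if i == 2 :> nat then 3 else 1) (jacobian i v).
Proof.
have g0 k : gR k 0 by exact: grading0 grR k.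
have gd j k r : gR k r -> gR k (delta_letter j r v).
  by rewrite /delta_letter; case: eqP.
have gz : gR 3 (z * z * z).
  by apply: (gRM (i := 2)) => //; apply: (gRM (i := 1)).
case: i => -[|[|[|[|[|i]]]]] //= _; rewrite /jacobian; try exact: gd.
  by apply: (gradingB grR); apply: gd.
by apply: (gradingB grR); apply: gd.
Qed.

Lemma alpha_gr n k :
  gR (if (k < 2)%N then 2 else if odd n then 3 else 1) (alpha n k).
Proof.
have g2 i j : gR 2 (x i * x j) by apply: (gRM (i := 1)).
have gz : gR 3 (z * z * z) by apply: (gRM (i := 2)).
by case: k => [|[|k]] /=; case: odd.
Qed.

Lemma resolution_mx_gr n i j : @resolution_mx n i j = 0 \/
  exists2 k, @resolution_deg n.+1 i = (k + @resolution_deg n j)%N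
    & gR k (resolution_mx i j).
Proof.
case: n => [|[|n]] in i j *.
- by right; exists 1%N => //; exact: gx.
- right; exists (if i == 2 :> nat then 3 else 1%N); last exact: jacobian_gr.
  by case: i => -[|[|[|[|[|i]]]]].
rewrite /resolution_mx; case: eqP => [ij|_]; last by left.
right; exists (if (i < 2)%N then 2 else if odd n then 3 else 1%N).
  2: exact: alpha_gr.
rewrite /resolution_deg -ij; case: ltnP => i2.
  by rewrite doubleS.
have -> : i = 2 :> nat by apply/eqP; rewrite eqn_leq i2 -ltnS ltn_ord.
rewrite eqxx /Defs.delta /= negbK uphalf_half.
case: (odd n) => /=; lia.
Qed.

Lemma resolution_mx_aug n i j : aug (@resolution_mx n i j) = 0.
Proof.
case: n => [|[|n]] in i j *.
- exact: augx.
- by apply: aug_gr (jacobian_gr _ _) _; case: ifP.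
rewrite /resolution_mx; case: eqP => _; last by rewrite raddf0.
by apply: aug_gr (alpha_gr _ _) _; case: ifP => // _; case: ifP.
Qed.

Lemma resolution_exact0 (r : fmod R unit) :
  aug (r tt) = 0 <-> exists y, r = mxmap (@resolution_mx 0) y.
Proof.
split=> [/span[y yE]|[y ->]].
  exists ([ffun v => (y v : R^o)] : fmod R X).
  apply/ffunP => -[]; rewrite mxmapE yE.
  by apply: eq_bigr => v _; rewrite ffunE.
by rewrite mxmapE raddf_sum big1 // => v _ /=; rewrite rmorphM augx mulr0.
Qed.

Lemma resolution_exact1 (r : fmod R X) :
  mxmap (@resolution_mx 0) r = 0 <-> exists y, r = mxmap (@resolution_mx 1) y.
Proof.
split=> [/ffunP/(_ tt)|[y ->]].
  rewrite mxmapE ffunE => /syzygy[t tE].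
  exists ([ffun i => (t i : R^o)] : fmod R 'I_5).
  apply/ffunP => v; rewrite mxmapE tE.
  by apply: eq_bigr => i _; rewrite ffunE.
apply/ffunP => -[]; rewrite mxmapE ffunE.
transitivity (\sum_i y i * \sum_v jacobian i v * x v).
  under eq_bigr do rewrite mxmapE mulr_suml.
  rewrite exchange_big; apply: eq_bigr => i _; rewrite mulr_sumr.
  by apply: eq_bigr => v _; rewrite mulrA.
by rewrite big1 // => i _; rewrite jacobian_syzygy mulr0.
Qed.

Lemma mxmap_alpha n (r : fmod R (res_gen n.+3)) (j : 'I_(res_size n)) :
  mxmap (@resolution_mx n.+2) r j =
    if (j < 3)%N then (r (inord j) : R) * alpha n j else 0.
Proof.
rewrite mxmapE; case: ltnP => j3.
  rewrite (bigD1 (inord j)) //= inordK // eqxx big1 ?addr0 // => i ij.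
  case: eqP => [E|_]; last by rewrite mulr0.
  by rewrite -E inord_val eqxx in ij.
apply: big1 => i _ /=; case: eqP => [E|_]; last by rewrite mulr0.
by move: (ltn_ord i); rewrite E ltnNge j3.
Qed.

Lemma res_size_ge3 n : (3 <= res_size n)%N.
Proof. by case: n. Qed.

Lemma mxmap_alphaP n (r : fmod R 'I_(res_size n)) :
  (exists y, r = mxmap (@resolution_mx n.+2) y) <->
  forall j, exists s, r j = if (j < 3)%N then s * alpha n j else 0.
Proof.
split=> [[y ->] j|/choice[s sE]].
  by rewrite mxmap_alpha; exists (y (inord j)).
exists ([ffun i => (s (widen_ord (res_size_ge3 n) i) : R^o)] : fmod R 'I_3).
apply/ffunP => j; rewrite mxmap_alpha sE; case: ltnP => // j3.
by rewrite ffunE; congr (s _ * _); apply: val_inj; rewrite /= inordK.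
Qed.

Lemma alpha_jacobian (i : 'I_5) v : (i < 3)%N -> alpha 0 i * jacobian i v = 0.
Proof.
have [cl ae z4 bc da] := relations.
case: i => -[|[|[|i]]] //= _ _; rewrite /delta_letter;
  case: eqP => _; rewrite ?mulr0 //.
- by rewrite -mulrA bc mulrA ae mul0r.
- by rewrite -mulrA da mulrA cl mul0r.
- by rewrite !mulrA.
Qed.

Lemma resolution_exact2 (r : fmod R 'I_5) :
  mxmap (@resolution_mx 1) r = 0 <-> exists y, r = mxmap (@resolution_mx 2) y.
Proof.
split=> [/ffunP r0|/(mxmap_alphaP (n := 0)) rE]; last first.
  apply/ffunP => v; rewrite mxmapE ffunE big1 // => i _.
  have [s ->] := rE i; case: ltnP => i3; last by rewrite mul0r.
  by rewrite -mulrA alpha_jacobian // mulr0.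
have {}r0 v : \sum_i (r i : R) * jacobian i v = 0.
  by have := r0 v; rewrite mxmapE ffunE.
have r1 k := r0 (letter k).
have {r1}[] : [/\ (r (inord 0) : R) * c = 0, (r (inord 1) : R) * a = 0,
    (r (inord 2) : R) * (z * z * z) = 0, (r (inord 3) : R) * b = 0
    & (r (inord 4) : R) * d = 0].
  (* Each of these five letters occurs in one row of the Jacobian only, so its column isolates one
     coordinate of [r]. *)
  split; [have := r1 6|have := r1 4|have := r1 8|have := r1 2|have := r1 0%N];
  by rewrite sum_jacobian /jacobian /delta_letter !letter_eq //=
    !(mulr0, add0r, addr0, subr0, sub0r, oppr0, mulrN).
move=> /ann_c r0c /ann_a r1a /ann_zzz r2z /ann_b r3b /ann_d r4d.
apply/(mxmap_alphaP (n := 0)) => j; rewrite -(inord_val j).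
case: j => -[|[|[|[|[|j]]]]] //= j5; rewrite !inordK //=.
- by exists 0; rewrite r3b.
- by exists 0; rewrite r4d.
Qed.

Lemma resolution_exact3 n (r : fmod R 'I_3) :
  mxmap (@resolution_mx n.+2) r = 0 <->
  exists y, r = mxmap (@resolution_mx n.+3) y.
Proof.
apply: iff_trans (iff_sym (mxmap_alphaP (n := n.+1) r)).
split=> [/ffunP r0 j|rE].
  rewrite ltn_ord; apply/alpha_ann.
  have := r0 (widen_ord (res_size_ge3 n) j).
  by rewrite mxmap_alpha ffunE /= ltn_ord inord_val.
apply/ffunP => j; rewrite mxmap_alpha ffunE; case: ltnP => // j3.
have [s] := rE (inord j); rewrite inordK // j3 => sE.
by apply/alpha_ann; exists s.
Qed.

Lemma resolution_deg0 (i : res_gen 0) : resolution_deg i = 0%N.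
Proof. by []. Qed.

Lemma resolution_eps_surj t : exists r : fmod R unit, fcoord aug tt r = t.
Proof. by exists [ffun => (kappa t : R^o)]; rewrite /fcoord ffunE kappaK. Qed.

Lemma resolution_exact n (r : fmod R (res_gen n.+1)) :
  mxmap (@resolution_mx n) r = 0 <->
  exists y, r = mxmap (@resolution_mx n.+1) y.
Proof.
case: n r => [|[|n]].
- exact: resolution_exact1.
- exact: resolution_exact2.
- exact: resolution_exact3.
Qed.

Definition min_resolution : minimal_resolution gR aug :=
  @MinimalResolution K R gR aug res_gen resolution_deg resolution_mx
    (@fcoord K R aug unit tt) resolution_mx_gr resolution_deg0
    resolution_mx_aug resolution_eps_surj resolution_exact0 resolution_exact.

Lemma resolution_deg_le n (i : res_gen n) :
  (resolution_deg i <= Defs.delta 4 n)%N.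
Proof.
case: n i => [|[|n]] i //; rewrite /resolution_deg.
case: ifP => _; last by case: ifP; rewrite // /Defs.delta /=; lia.
by rewrite /Defs.delta /=; lia.
Qed.

(** * Divisibility by [ab] or [cd], and indecomposable classes *)

Let fst_letter m := if odd m then 2 else 0%N.
Let snd_letter m := if odd m then 3 else 1%N.

Arguments alpha : simpl never.

Lemma alpha0E m : alpha m 0 = 'x_(fst_letter m) * 'x_(snd_letter m).
Proof. by rewrite /alpha /fst_letter /snd_letter; case: odd. Qed.

(** Writing [y] as a constant plus a combination of letters gives one explicit solution [w], the
    constant being carried by the last letter of [alpha m 0]. Any other solution differs from it by
    a syzygy. *)
Lemma alpha_divides m w y : \sum_v w v * x v = alpha m 0 * y ->
  exists y' (t : 'I_5 -> R), forall v, w v = alpha m 0 * y' v +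
    delta_letter (snd_letter m) ('x_(fst_letter m) * kappa (aug y)) v +
    \sum_i t i * jacobian i v.
Proof.
move=> wE; have [|y' y'E] := @span (y - kappa (aug y)).
  by rewrite raddfB /= kappaK subrr.
exists y'; have [|t tE] := @syzygy (fun v => w v - (alpha m 0 * y' v +
    delta_letter (snd_letter m) ('x_(fst_letter m) * kappa (aug y)) v)).
  transitivity (\sum_v w v * x v - (alpha m 0 * (\sum_v y' v * x v) +
    'x_(fst_letter m) * kappa (aug y) * 'x_(snd_letter m))).
    rewrite -sum_delta_letter mulr_sumr -big_split -sumrB.
    by apply: eq_bigr => v _; rewrite mulrBl mulrDl mulrA.
  rewrite wE -y'E -mulrA kappaC mulrA -alpha0E mulrBr.
  by rewrite subrK subrr.
by exists t => v; rewrite -tE addrC subrK.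
Qed.

Lemma alpha_aug m k : aug (alpha m k) = 0.
Proof. by apply: aug_gr (alpha_gr _ _) _; case: ifP => // _; case: ifP. Qed.

Lemma alpha_divides_aug m w y v :
  \sum_v w v * x v = alpha m 0 * y -> aug (w v) = 0.
Proof.
move=> /alpha_divides[y' [t ->]]; rewrite !raddfD /= rmorphM /= alpha_aug mul0r.
rewrite add0r raddf_sum big1 => [|i _] /=; last first.
  by rewrite rmorphM /= (aug_gr (jacobian_gr i v)) ?mulr0 //; case: ifP.
rewrite addr0 /delta_letter; case: eqP => _; last exact: raddf0.
by rewrite rmorphM /= augx mul0r.
Qed.

Lemma alpha_divides_letter m k p y : p * 'x_k = alpha m 0 * y -> aug p = 0.
Proof.
rewrite -sum_delta_letter => /(@alpha_divides_aug _ _ _ (letter k)).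
by rewrite /delta_letter eqxx.
Qed.

Lemma jacobian_snd (i : 'I_5) m : jacobian i (letter (snd_letter m)) = 0.
Proof.
case: i => -[|[|[|[|[|i]]]]] //= _; rewrite /snd_letter /delta_letter;
  by case: odd; rewrite !letter_eq //= ?subr0.
Qed.

(** The condition [aug y = 0] rules out [p = y = 1]. Under it the last letter of [alpha n k], which
    ends no relation, can be cancelled, leaving [p] times a single letter. *)
Lemma alpha_divides_alpha m n k p y : (k < 2)%N ->
  p * alpha n k = alpha m 0 * y -> aug y = 0 -> aug p = 0.
Proof.
(* The two sequences of [ab] and [cd] are shifts of each other. *)
move=> k2; have [n' ->] : exists n', alpha n k = alpha n' 0.
  case: k k2 => [|[|//]] _; first by exists n.
  by exists n.+1; rewrite /alpha /=; case: odd.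
rewrite [alpha n' 0]alpha0E mulrA -sum_delta_letter.
move=> /alpha_divides[y' [t tE]] y0.
have := tE (letter (snd_letter n')); rewrite [in LHS]/delta_letter eqxx.
rewrite [\sum_i _]big1 => [|i _]; last by rewrite jacobian_snd mulr0.
rewrite y0 raddf0 mulr0 /delta_letter if_same !addr0.
exact: alpha_divides_letter.
Qed.

Lemma alpha_divides_z m q y : q * z = alpha m 0 * y ->
  exists t y', q = alpha m 0 * y' + t * (z * z * z).
Proof.
rewrite -sum_delta_letter => /alpha_divides[y' [t tE]].
exists (t (inord 2)), (y' (letter 8)).
have := tE (letter 8); rewrite {1}/delta_letter eqxx => ->.
rewrite sum_jacobian /jacobian /delta_letter !letter_eq //=; last first.
  by rewrite /snd_letter; case: odd.
rewrite !(mulr0, add0r, addr0, subr0, sub0r, oppr0, mulrN).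
by rewrite /snd_letter; case: odd; rewrite /= addr0.
Qed.

(** As for the annihilator of [z * z * z], one [z] is removed at a time; the correction terms end in
    [z] and have augmentation 0. *)
Lemma alpha_divides_zzz m p y : p * (z * z * z) = alpha m 0 * y -> aug p = 0.
Proof.
have zzz0 : aug z = 0 by exact: augx.
rewrite !mulrA => /alpha_divides_z[t [y1 /eqP]].
rewrite !mulrA -subr_eq -!mulrBl => /eqP/alpha_divides_z[s [y2 /eqP]].
rewrite !mulrA -subr_eq -!mulrBl => /eqP/alpha_divides_letter.
by rewrite !raddfB /= !rmorphM /= zzz0 !mulr0 !subr0.
Qed.

Lemma alpha_divides_alpha2 m n p y : p * alpha n 2 = alpha m 0 * y -> aug p = 0.
Proof.
by rewrite /alpha; case: (odd n);
  [apply: alpha_divides_zzz|apply: alpha_divides_letter].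
Qed.

Definition fst_gen n : res_gen n.+2 :=
  Ordinal (leq_trans (isT : 0 < 3)%N (res_size_ge3 n)).

Lemma mxmap_fst_gen n : mxmap (@resolution_mx n.+2) (fbasis R (fst_gen n.+1)) =
  alpha n 0 *: (fbasis R (fst_gen n) : fmod R (res_gen n.+2)).
Proof.
rewrite /mxmap /= fmod_ext_basis; apply/ffunP => j.
rewrite fmodZE !ffunE -val_eqE /=.
by case: eqP => _; rewrite ?mulr1 ?mulr0.
Qed.

Lemma fst_gen_indecomposable m :
  @indecomposable K R gR aug min_resolution m.+3 (fst_gen m.+1).
Proof.
move=> H Hd; case=> // n.
have dH k j v : mxmap (@resolution_mx j)
    (H k.+3 j.+1 (fbasis R (fst_gen k.+1))) v =
    alpha k 0 * H k.+2 j (fbasis R (fst_gen k)) v.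
  have E := etrans (Hd k.+2 j (fbasis R (fst_gen k.+1)))
    (congr1 (H k.+2 j) (mxmap_fst_gen k)).
  by rewrite [LHS](congr1 (fun r : fmod R _ => r v) E) linearZ_LR fmodZE.
(* Induction on the target degree [n.+1] for all [m]. The differential out of it is given by the
   letters, then by the Jacobian, then by a diagonal matrix; in the last case the induction
   hypothesis supplies [aug y = 0] for the indices below 2. *)
elim: n m => [|[|n] IH] m /andP[_ nm] i.
- by have := dH m 0%N tt; rewrite mxmapE; apply: alpha_divides_aug.
- have dHl k := dH m 1%N (letter k); move: dHl.
  move: (H m.+3 2 _) => w dHl; rewrite -[i]inord_val.
  case: i => -[|[|[|[|[|i]]]]] //= _; [move: (dHl 6)|move: (dHl 4)|
    move: (dHl 8)|move: (dHl 2)|move: (dHl 0%N)];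
  rewrite mxmapE sum_jacobian /jacobian /delta_letter !letter_eq //=
    !(mulr0, add0r, addr0, subr0, sub0r, oppr0);
  by [apply: alpha_divides_letter|apply: alpha_divides_zzz].
case: m => // m in nm *.
have := dH m.+1 n.+2 (widen_ord (res_size_ge3 n) i).
rewrite mxmap_alpha /= ltn_ord inord_val => wE.
have [i2|i2] := ltnP i 2.
  apply: (alpha_divides_alpha i2 wE); apply: IH.
  by rewrite andTb.
suff i2E : i = 2 :> nat by rewrite i2E in wE; apply: alpha_divides_alpha2 wE.
by apply/eqP; rewrite eqn_leq i2 -ltnS ltn_ord.
Qed.

Lemma resolution_ext_eq0 (P : resolution gR aug) i j :
  (Defs.delta 4 i < j)%N -> ext_eq0 P i j.
Proof.
move=> ij; apply: (ext_eq0_deg grR aug_gr (Q := min_resolution)) => k kj.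
by move: (resolution_deg_le k); rewrite leqNgt [resolution_deg k]kj ij.
Qed.

Lemma resolution_not_fin_gen (P : resolution gR aug) : ~ yoneda_fin_gen P.
Proof.
apply: (yoneda_not_fin_gen grR aug_gr (Q := min_resolution)) => [t|N].
  by exists (kappa t).
exists N.+2, (fst_gen N.+1); first by rewrite leqW.
exact: fst_gen_indecomposable.
Qed.

End Syzygies.

(** * The presentation of C *)

Section FreeMap.
Variables (K : fieldType) (X Y : choiceType) (s : X -> Y).

Let word_map (w : {fmonom X}) : free_alg K Y :=
  << \big[mmul/1%M]_(x <- w) fmu (s x) >>.

Lemma free_mapE p : free_map s p = mmap (@malgC {fmonom Y} K) word_map p.
Proof. by apply: eq_bigr => w _; rewrite mulUU mul1m mulr1. Qed.

Lemma free_mapB p q :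
  free_map s (p - q) = free_map s p - free_map s q :> free_alg K Y.
Proof. by rewrite !free_mapE mmapB. Qed.

Lemma free_map_var x : free_map s (var K x) = var K (s x).
Proof.
by rewrite free_mapE mmapU mulUU mul1m mulr1 fmU big_seq1.
Qed.

Lemma free_mapMvar p x : free_map s (p * var K x) = free_map s p * var K (s x).
Proof.
have f0 : free_map s 0 = 0 :> free_alg K Y by rewrite free_mapE mmap0.
have fD : {morph free_map s : p q / p + q >-> p + q :> free_alg K Y}.
  by move=> q r; rewrite !free_mapE mmapD.
have fU c (w : {fmonom X}) : free_map s << c *g w >> =
    << c *g \big[mmul/1%M]_(y <- w) fmu (s y) >> :> free_alg K Y.
  by rewrite free_mapE mmapU mulUU mul1m mulr1.
rewrite (monalgE p) mulr_suml !(big_morph _ fD f0) mulr_suml.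
apply: eq_bigr => w _; rewrite mulUU !fU mulUU fmM fmU big_cat big_seq1.
by [].
Qed.

End FreeMap.

Section Relations.
Variable K : fieldType.

(** Numbered as the rows of [jacobian]; the choice of letters [y] is free, so that one formula
    serves both factors and their free product. *)
Definition relation (X : choiceType) (y : nat -> X) (k : nat) : free_alg K X :=
  match k with
  | 0 => var K (y 2%N) * var K (y 6%N)
  | 1 => var K (y 0%N) * var K (y 4%N)
  | 2 => var K (y 8%N) * var K (y 8%N) * var K (y 8%N) * var K (y 8%N)
  | 3 => var K (y 1%N) * var K (y 2%N) - var K (y 4%N) * var K (y 5%N)
  | _ => var K (y 3%N) * var K (y 0%N) - var K (y 6%N) * var K (y 7%N)
  end.

Lemma free_map_relation (X Y : choiceType) (s : X -> Y) y k :
  free_map s (relation y k) = relation (s \o y) k.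
Proof.
have f2 u v : free_map s (var K u * var K v) = var K (s u) * var K (s v).
  by rewrite free_mapMvar free_map_var.
have fB u v u' v' : free_map s (var K u * var K v - var K u' * var K v') =
    var K (s u) * var K (s v) - var K (s u') * var K (s v').
  exact: etrans (free_mapB _ _ _) (congr2 (fun p q => p - q) (f2 _ _) (f2 _ _)).
case: k => [|[|[|[|k]]]]; rewrite /relation; try exact: f2; try exact: fB.
by rewrite !free_mapMvar free_map_var.
Qed.

Lemma eq_relation (X : choiceType) (y y' : nat -> X) k :
  k != 2 -> (forall i, (i < 8)%N -> y i = y' i) -> relation y k = relation y' k.
Proof.
move=> k2 yy'; have Y i (i8 : (i < 8)%N) := yy' i i8.
case: k k2 => [|[|[|[|k]]]] k2; rewrite /relation.
- by rewrite (Y 2%N isT) (Y 6%N isT).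
- by rewrite (Y 0%N isT) (Y 4%N isT).
- by case/eqP: k2.
- by rewrite (Y 1%N isT) (Y 2%N isT) (Y 4%N isT) (Y 5%N isT).
- by rewrite (Y 3%N isT) (Y 0%N isT) (Y 6%N isT) (Y 7%N isT).
Qed.

Lemma fox_relation (X : finType) (y : nat -> X) v (R : nzRingType)
    (h : {rmorphism free_alg K X -> R}) k :
  h (fox v (relation y k)) = jacobian y (fun u => h (var K u)) k v.
Proof.
have D i (p : free_alg K X) :
    h (fox v (p * var K (y i))) = delta_letter y i (h p) v.
  by rewrite foxMvar /delta_letter eq_sym; case: eqP => // _; rewrite raddf0.
have foxB (p q p' q' : free_alg K X) :
    h (fox v (p * q - p' * q')) = h (fox v (p * q)) - h (fox v (p' * q')).
  by rewrite (raddfB (fox v)); exact: raddfB.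
case: k => [|[|[|[|k]]]]; rewrite /relation /jacobian.
- exact: D.
- exact: D.
- by rewrite D !rmorphM.
- exact: etrans (foxB _ _ _ _) (congr2 (fun p q => p - q) (D 2%N _) (D 5%N _)).
- exact: etrans (foxB _ _ _ _) (congr2 (fun p q => p - q) (D 0%N _) (D 7%N _)).
Qed.

(** The list follows the order of [A_rels]: [bc - ef], [ae], [da - lm], [cl]. Index 2 is the
    relation of the other factor. *)
Lemma A_relsP p : @A_rels K p <-> exists2 k, k \in [:: 3; 1; 4; 0]%N &
  p = relation (fun i => inord i : 'I_8) k.
Proof.
pose r k := relation (fun i => inord i : 'I_8) k.
rewrite -[A_rels p]/(is_true (p \in [seq r k | k <- [:: 3; 1; 4; 0]%N])).
by split=> [/mapP|?]; [|exact/mapP].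
Qed.

Lemma B_relsE p : @B_rels K p <-> p = relation (fun=> tt) 2.
Proof. by rewrite -[B_rels p]/(p = _) !exprSr expr0 mul1r. Qed.

(* Letters 0 to 7 are a, b, c, d, e, f, l, m; letter 8 is z. *)
Definition C_letter (k : nat) : ('I_8 + unit)%type :=
  if (k < 8)%N then inl (inord k) else inr tt.

Lemma C_letter_eq i j : (i < 9)%N -> (j < 9)%N ->
  (C_letter i == C_letter j) = (i == j).
Proof.
move=> i9 j9; rewrite /C_letter; case: (ltnP i 8) => i8; case: (ltnP j 8) => j8.
- by rewrite -[LHS]/(inord i == inord j :> 'I_8) -val_eqE /= !inordK.
- by rewrite ltn_eqF // (leq_trans i8).
- by rewrite gtn_eqF // (leq_trans j8).
- have -> : i = 8 by apply/eqP; rewrite eqn_leq i8 andbT.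
  have -> : j = 8 by apply/eqP; rewrite eqn_leq j8 andbT.
  by rewrite !eqxx.
Qed.

Lemma relation_inl k : k \in [:: 3; 1; 4; 0]%N ->
  free_map inl (relation (fun i => inord i : 'I_8) k) =
    @relation ('I_8 + unit)%type C_letter k.
Proof.
move=> k4; rewrite free_map_relation; apply: eq_relation => [|i i8].
  by move: k4; rewrite !inE => /or4P[] /eqP->.
by rewrite /C_letter i8.
Qed.

Lemma relation_inr : free_map inr (relation (fun=> tt) 2) =
  @relation ('I_8 + unit)%type C_letter 2.
Proof. exact: free_map_relation. Qed.

Lemma C_relsP p : @rels K (C_alg K) p <->
  exists i : 'I_5, p = @relation (gens (C_alg K)) C_letter i.
Proof.
split=> [[[q /A_relsP[k k4 ->] <-]|[q /B_relsE-> <-]]|[i ->]].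
- have k5 : (k < 5)%N by move: k4; rewrite !inE => /or4P[] /eqP->.
  exists (Ordinal k5); exact: relation_inl.
- exists (Ordinal (isT : 2 < 5)%N); exact: relation_inr.
- have [i2|i2] := eqVneq (nat_of_ord i) 2.
    right; exists (relation (fun=> tt) 2); first exact/B_relsE.
    by rewrite i2; exact: relation_inr.
  have i4 : nat_of_ord i \in [:: 3; 1; 4; 0]%N.
    by case: i i2 => -[|[|[|[|[|]]]]].
  left; exists (relation (fun j => inord j : 'I_8) i).
    by apply/A_relsP; exists (nat_of_ord i).
  exact: relation_inl.
Qed.

End Relations.

Section CAlgebra.
Variable K : fieldType.
Local Notation C := (C_alg K).

Definition C_rel (i : 'I_5) : free_alg K (gens C) := relation K C_letter i.

Definition C_gen (v : gens C) : alg C := @pi K C (var K v).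

Definition C_const : {rmorphism K -> alg C} := @pi K C \o @malgC _ K.

Lemma C_grM i j (r t : alg C) :
  alg_gr i r -> alg_gr j t -> alg_gr (i + j) (r * t).
Proof.
by move=> [p hp ->] [q hq ->]; exists (p * q); [apply: homogM|rewrite rmorphM].
Qed.

Lemma C_aug_gr j (r : alg C) : alg_gr j r -> (0 < j)%N -> aug r = 0.
Proof.
move=> [p hp ->] j0; rewrite aug_pi; apply: mcoeff_outdom.
by apply/negP => /hp; rewrite fdeg1 => jE; rewrite -jE in j0.
Qed.

Lemma C_gen_gr v : alg_gr 1 (C_gen v).
Proof. by exists (var K v) => //; apply: homog_var. Qed.

Lemma C_constK : cancel C_const (@aug K C).
Proof. exact: aug_malgC. Qed.

Lemma C_jac (i : 'I_5) v : jac C_rel i v = jacobian C_letter C_gen i v.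
Proof. exact: fox_relation. Qed.

Lemma C_syzygy (y : gens C -> alg C) : \sum_v y v * C_gen v = 0 ->
  exists t : 'I_5 -> alg C, forall v,
    y v = \sum_i t i * jacobian C_letter C_gen i v.
Proof.
move=> /(gens_syzygy (@C_relsP K))[t tE]; exists t => v; rewrite tE.
by apply: eq_bigr => i _; rewrite -C_jac.
Qed.

Lemma C_jacobian_syzygy (i : 'I_5) :
  \sum_v jacobian C_letter C_gen i v * C_gen v = 0.
Proof.
apply: etrans (jac_syzygy (@C_relsP K) i).
by apply: eq_bigr => v _; rewrite -C_jac.
Qed.

Lemma C_relations_deg p : @rels K C p -> homog 2 p \/ homog 4 p.
Proof.
have h2 (X : choiceType) (u v : X) : homog 2 (var K u * var K v).
  exact: (homogM (@homog_var _ _ _) (@homog_var _ _ _)).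
case=> -[q + <-] => [/A_relsP[k k4 ->]|/B_relsE->]; [left|right].
  apply: free_map_homog; case: k k4 => [|[|[|[|k]]]] // _; rewrite /relation.
  - exact: h2.
  - exact: h2.
  - by apply: homogB; apply: h2.
  - by apply: homogB; apply: h2.
apply: free_map_homog; rewrite /relation.
apply: (homogM (m := 3)); last exact: homog_var.
by apply: (homogM (m := 2)); [exact: h2|exact: homog_var].
Qed.

End CAlgebra.

Theorem theorem3p5 (K : fieldType) :
  two_D_determined (C_alg K) 4 /\
  forall P : alg_resolution (C_alg K), ~ yoneda_fin_gen P.
Proof.
split; first split.
- by exists (@rels K (C_alg K)); split=> // p; apply: C_relations_deg.
- move=> P i j ij.
  apply: (resolution_ext_eq0 C_letter_eq (@alg_grading K (C_alg K))
    (@C_grM K) (@C_aug_gr K) (@C_gen_gr K) (@C_constK K)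
    (@C_syzygy K) (@C_jacobian_syzygy K)
    (@gens_span K (C_alg K)) ij).
- move=> P.
  apply: (resolution_not_fin_gen C_letter_eq (@alg_grading K (C_alg K))
    (@C_grM K) (@C_aug_gr K) (@C_gen_gr K) (@C_constK K)
    (@pi_malgC_comm K (C_alg K)) (@C_syzygy K) (@C_jacobian_syzygy K)
    (@gens_span K (C_alg K))).
Qed.
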